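(* Let $\mathfrak{A}$ be a von Neumann algebra acting on a complex Hilbert space $\mathcal{H}$ and let $\operatorname{Aff}(\mathfrak{A})$ be the set of all operators affiliated with $\mathfrak{A}$. Assume there exists a function $\varphi \colon \operatorname{Aff}(\mathfrak{A}) \to \operatorname{Aff}(\mathfrak{A})$ with the following properties: (a) if $A, B \in \mathfrak{A}$ are such that $\varphi(A) \in \mathfrak{A}$, then $\varphi(\alpha A + \beta B) = \alpha \varphi(A) + \beta \varphi(B)$ for all scalars $\alpha, \beta \in \mathbb{C}$; (b) $\varphi(A)$ is non-negative whenever $A \in \operatorname{Aff}(\mathfrak{A})$ is non-negative; (c) if $A \in \operatorname{Aff}(\mathfrak{A})$ and $B \in \mathfrak{A}$ are non-negative, and $\varphi(B) \in \mathfrak{A}$, then $\varphi(A + B) = \varphi(A) + \varphi(B)$; (d) $\varphi(AB) = \varphi(BA)$ for all $A, B \in \mathfrak{A}$; (e) $\varphi(Z) = Z$ for each $Z \in \mathcal{Z}(\mathfrak{A})$; (f) if $A, U \in \mathfrak{A}$ and $U$ is unitary, then $U^* \varphi(A) U = \varphi(A)$. Then $\mathfrak{A}$ is finite and type I.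
   Context: All operators are linear, closed and densely defined in $\mathcal{H}$; non-negative operators are by definition self-adjoint. An operator $T$ in $\mathcal{H}$ is affiliated with $\mathfrak{A}$ if $UTU^{-1} = T$ for every unitary operator $U$ in the commutant $\mathfrak{A}'$. $\mathcal{Z}(\mathfrak{A})$ is the center of $\mathfrak{A}$. In general $\operatorname{Aff}(\mathfrak{A})$ is not a vector space, but it is closed under scalar multiples, and for $T \in \operatorname{Aff}(\mathfrak{A})$ and $S \in \mathfrak{A}$ the operator $T + S$ (with domain that of $T$) is a well-defined member of $\operatorname{Aff}(\mathfrak{A})$; the sums in (a) and (c) are understood in this sense. *)

(* Defs.v *)
From HB Require Import structures.
From mathcomp Require Import all_boot all_order all_algebra sesquilinear.
From mathcomp Require Import all_classical all_reals all_analysis.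
From mathcomp Require Import complex.

Set Implicit Arguments.
Unset Strict Implicit.
Unset Printing Implicit Defensive.

Import Order.TTheory GRing.Theory Num.Theory.
Import numFieldNormedType.Exports.

Local Open Scope classical_set_scope.
Local Open Scope ring_scope.

(* A complex Hilbert space is a complete normed module H over R[i] together
   with a positive definite form [dot], linear in its first argument and
   conjugate-linear in the second, that induces the norm of H. *)
Definition hilbert_form (R : realType) (H : completeNormedModType R[i])
    (dot : {dot H for (@Num.conj R[i])}) : Prop :=
  forall x : H, `|x| ^+ 2 = dot x x.

(* Operators in H are represented by their graphs, so that equality of
   operators includes equality of domains; a bounded operator is an everywhere
   defined one, and lives in the same type. *)
Definition oper (R : realType) (H : completeNormedModType R[i]) : Type :=
  set (H * H).

Section Operators.
Context (R : realType) (H : completeNormedModType R[i]).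
Implicit Types (T S : oper H).

Definition dom T : set H := [set x | exists y, T (x, y)].

Definition ran T : set H := [set y | exists x, T (x, y)].

Definition linear_op T : Prop :=
  [/\ forall x y z, T (x, y) -> T (x, z) -> y = z,
      T (0, 0) &
      forall (a : R[i]) x y x' y', T (x, y) -> T (x', y') ->
        T (a *: x + x', a *: y + y')].

Definition closed_densely_defined T : Prop :=
  [/\ linear_op T, closed (T : set (H * H)%type) & dense (dom T)].

Definition bounded_op T : Prop :=
  [/\ linear_op T, dom T = setT &
      exists c : R[i], forall x y, T (x, y) -> `|y| <= c * `|x|].

Definition op0 : oper H := [set p | p.2 = 0].

Definition op1 : oper H := [set p | p.2 = p.1].

Definition op_add T S : oper H :=
  [set p | exists y z, [/\ T (p.1, y), S (p.1, z) & p.2 = y + z]].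

(* For T unbounded, the restriction of 0 to the domain of T is not closed; the
   zero multiple is therefore the everywhere defined zero operator, which is
   what makes closed operators stable under scalar multiples. *)
Definition op_scale (a : R[i]) T : oper H :=
  if a == 0 then op0 else [set p | exists2 y, T (p.1, y) & p.2 = a *: y].

(* [op_mul T S] is the product TS: S is applied first. *)
Definition op_mul T S : oper H :=
  [set p | exists2 y, S (p.1, y) & T (y, p.2)].

Definition op_inv T : oper H := [set p | T (p.2, p.1)].

Definition commutant (M : set (oper H)) : set (oper H) :=
  [set T | bounded_op T /\ forall S, M S -> op_mul T S = op_mul S T].

Definition vn_center (M : set (oper H)) : set (oper H) := M `&` commutant M.

End Operators.

Arguments op0 {R} H.
Arguments op1 {R} H.

Section Hilbert.
Context (R : realType) (H : completeNormedModType R[i]).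
Context (dot : {dot H for (@Num.conj R[i])}).
Implicit Types (T E F : oper H) (M : set (oper H)).

Definition op_adj T : oper H :=
  [set p | forall x y, T (x, y) -> dot y p.1 = dot x p.2].

Definition nonneg_op T : Prop :=
  op_adj T = T /\ forall x y, T (x, y) -> 0 <= dot y x.

Definition unitary_op T : Prop :=
  [/\ bounded_op T, op_mul (op_adj T) T = op1 H & op_mul T (op_adj T) = op1 H].

(* Stability under linear combinations and products, and the presence of the
   identity, follow from M'' = M. *)
Definition von_neumann_algebra M : Prop :=
  [/\ forall T, M T -> bounded_op T,
      forall T, M T -> M (op_adj T) &
      commutant (commutant M) = M].

Definition affiliated M : set (oper H) :=
  [set T | closed_densely_defined T /\
     forall U, commutant M U -> unitary_op U ->
       op_mul (op_mul U T) (op_inv U) = T].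

Definition projection M E : Prop :=
  [/\ M E, op_adj E = E & op_mul E E = E].

Definition proj_le E F : Prop := ran E `<=` ran F.

(* Murray-von Neumann equivalence relative to M. *)
Definition proj_equiv M E F : Prop :=
  exists V, [/\ M V, op_mul (op_adj V) V = E & op_mul V (op_adj V) = F].

Definition finite_projection M E : Prop :=
  forall F, projection M F -> proj_le F E -> proj_equiv M E F -> F = E.

Definition finite_algebra M : Prop := finite_projection M (op1 H).

Definition corner E T : oper H := op_mul (op_mul E T) E.

Definition abelian_projection M E : Prop :=
  projection M E /\
  forall A B, M A -> M B ->
    op_mul (corner E A) (corner E B) = op_mul (corner E B) (corner E A).

Definition type_I M : Prop :=
  forall Z, projection M Z -> vn_center M Z -> Z <> op0 H ->
    exists E, [/\ abelian_projection M E, proj_le E Z & E <> op0 H].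

End Hilbert.

(* Main.v *)
(* Applying (a) and (b) to [c - A >= 0] shows that [phi] maps positive elements of
   the algebra to bounded ones, so on them it is a positive trace that fixes the
   center.

   Finiteness. A projection [E = E' + E''] with [E ~ E' ~ E''] satisfies
   [phi E = 2 phi E], that is [phi E = 0]. By Zorn's lemma there is a maximal such
   [E] together with its splitting. Comparing [E] with [1 - E] yields either a
   central projection [z] with [z = phi z = 0] or a copy of [E] under [1 - E],
   against maximality, unless [E = 0]. A non-unitary isometry [S] produces a nonzero
   [E]: the sum of the projections [S^n (1 - S S^* ) S^*^n].

   Type I. If a central projection [Z] dominates no abelian projection, every
   projection under [Z] is, by Zorn's lemma, the sum of two equivalent ones, for a
   non-abelian corner contains a nonzero operator of square zero. Halving [Z]
   repeatedly gives orthogonal [P_n] with [phi P_n = 2^(-n-1) Z]. The operator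
   [A = sum_n 2^(n+1) P_n] is affiliated and, by (c), [phi A >= N Z] for every [N],
   so [Z] vanishes on the dense domain of [phi A]. *)
Require Import Defs.
From mathcomp Require Import all_boot all_order all_algebra sesquilinear.
From mathcomp Require Import all_classical all_reals all_analysis.
From mathcomp Require Import complex.
From mathcomp Require Import ring lra.

Set Implicit Arguments.
Unset Strict Implicit.
Unset Printing Implicit Defensive.

Import Order.TTheory GRing.Theory Num.Theory.
Import numFieldNormedType.Exports.

Local Open Scope classical_set_scope.
Local Open Scope complex_scope.
Local Open Scope ring_scope.

(** No continuity of [phi] is assumed, so [phi] may only meet finite sums: every infinite sum is
    formed inside the algebra first, by Zorn's lemma, and [phi] sees the resulting finite relation.
    This is why finiteness goes through projections that split into two copies of themselves, and
    why the type I part uses one unbounded operator from which a bounded part is split off for each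
    [N]. The weights 2^(n+1) give every term the same image [Z]. Partial isometries are built as
    graphs: a subspace of pairs that is isometric and invariant under the commutant closes up to a
    partial isometry of the algebra. Unions of chains of such subspaces are again of this kind, so
    Zorn's lemma applies without limits of operators. The only functional calculus is the positive
    square root. It supplies absolute values, polar decompositions, the unitaries of the commutant,
    and the sign projections that stand in for the spectral theorem. *)

Section Hilbert.
Context (R : realType) (H : completeNormedModType R[i]).
Context (dot : {dot H for (@Num.conj R[i])}).
Hypothesis hdot : hilbert_form dot.
Implicit Types x y z : H.

(* The order of [R[i]] is partial, so estimates use the real part of the form
   and the norm as a real number. *)
Definition ip x y : R := complex.Re (dot x y).
Definition rn x : R := complex.Re `|x|.

Lemma dotDl x y z : dot (x + y) z = dot x z + dot y z.
Proof. by have := linearPl dot z 1 x y; rewrite scale1r mul1r. Qed.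

Lemma dotZl a x y : dot (a *: x) y = a * dot x y.
Proof. by rewrite -[a *: x]addr0 linearPl linear0l addr0. Qed.

Lemma dotNl x y : dot (- x) y = - dot x y.
Proof. by rewrite -scaleN1r dotZl mulN1r. Qed.

Lemma dot0l x : dot 0 x = 0.
Proof. by rewrite linear0l. Qed.

Lemma dotC x y : dot x y = (dot y x)^*%C.
Proof. by rewrite hermC expr0 mul1r. Qed.

Lemma dotZr a x y : dot x (a *: y) = a^*%C * dot x y.
Proof. by rewrite -[a *: y]addr0 linearPr linear0r addr0. Qed.

Lemma ipC x y : ip x y = ip y x.
Proof. by rewrite /ip dotC; case: (dot y x). Qed.

Lemma ipDl x y z : ip (x + y) z = ip x z + ip y z.
Proof. by rewrite /ip dotDl; case: (dot x z); case: (dot y z). Qed.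

Lemma ipDr x y z : ip x (y + z) = ip x y + ip x z.
Proof. by rewrite ipC ipDl !(ipC x). Qed.

Lemma ipZl (c : R) x y : ip (c%:C *: x) y = c * ip x y.
Proof.
rewrite /ip dotZl.
by case: (dot x y) => a b /=; rewrite mul0r subr0.
Qed.

Lemma ipZr (c : R) x y : ip x (c%:C *: y) = c * ip x y.
Proof. by rewrite ipC ipZl ipC. Qed.

Lemma ipNl x y : ip (- x) y = - ip x y.
Proof. by rewrite -scaleN1r -(rmorphN1 (real_complex R)) ipZl mulN1r. Qed.

Lemma ipNr x y : ip x (- y) = - ip x y.
Proof. by rewrite ipC ipNl ipC. Qed.

Lemma ip0l x : ip 0 x = 0.
Proof. by rewrite /ip linear0l. Qed.

Lemma ip0r x : ip x 0 = 0.
Proof. by rewrite ipC ip0l. Qed.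

Definition ipE := (ipDl, ipDr, ipNl, ipNr, ipZl, ipZr, ip0l, ip0r).

Lemma normE x : `|x| = (rn x)%:C.
Proof. by rewrite /rn RRe_real// ger0_real. Qed.

Lemma rn_ge0 x : 0 <= rn x.
Proof. by have := normr_ge0 x; rewrite normE ler0c. Qed.

Lemma rn2 x : rn x ^+ 2 = ip x x.
Proof. by rewrite /ip -hdot normE -rmorphXn. Qed.

Lemma rnD x y : rn (x + y) <= rn x + rn y.
Proof. by have := ler_normD x y; rewrite !normE -rmorphD lecR. Qed.

Lemma rnN x : rn (- x) = rn x.
Proof. by rewrite /rn normrN. Qed.

Lemma rnB x y : rn (x - y) <= rn x + rn y.
Proof. by rewrite -(rnN y) rnD. Qed.

Lemma rn_sub x y : rn (x - y) = rn (y - x).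
Proof. by rewrite /rn distrC. Qed.

Lemma rnZ (a : R[i]) x : rn (a *: x) = complex.Re `|a| * rn x.
Proof.
by rewrite /rn normrZ -(RRe_real (ger0_real (normr_ge0 a))) normE -rmorphM.
Qed.

Lemma nc_ge0 (a : R[i]) : 0 <= complex.Re `|a|.
Proof. by rewrite normc_def /= sqrtr_ge0. Qed.

Lemma ncC (c : R) : complex.Re `|c%:C| = `|c|.
Proof. by rewrite normc_def /= expr0n addr0 sqrtr_sqr. Qed.

Lemma rnZC (c : R) x : rn (c%:C *: x) = `|c| * rn x.
Proof. by rewrite rnZ ncC. Qed.

Lemma rn0 : rn 0 = 0.
Proof. by rewrite /rn normr0. Qed.

Lemma rn_eq0 x : rn x = 0 -> x = 0.
Proof. by move=> h; apply/normr0_eq0; rewrite normE h. Qed.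

Lemma rn_le2 x y : (rn x <= rn y) = (ip x x <= ip y y).
Proof. by rewrite -!rn2 ler_sqr ?nnegrE ?rn_ge0. Qed.

Lemma rn_small x : (forall e, 0 < e -> rn x <= e) -> x = 0.
Proof.
move=> h; apply: rn_eq0; apply/eqP; rewrite eq_le rn_ge0 andbT.
by apply/ler_addgt0Pr => e e0; rewrite add0r h.
Qed.

Lemma ip_eq0 x : ip x x = 0 -> x = 0.
Proof. by rewrite -rn2 => /eqP; rewrite sqrf_eq0 => /eqP/rn_eq0. Qed.

Lemma ip_ge0 x : 0 <= ip x x.
Proof. by rewrite -rn2 sqr_ge0. Qed.

Lemma ip_ext x y : (forall w, ip x w = ip y w) -> x = y.
Proof.
move=> h; apply/eqP; rewrite -subr_eq0; apply/eqP/ip_eq0.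
by rewrite {1}ipDl ipNl h subrr.
Qed.

Lemma dotE x y : dot x y = (ip x y) +i* (ip x ('i *: y)).
Proof.
rewrite /ip dotZr.
by case: (dot x y) => a b /=; congr (_ +i* _); ring.
Qed.

Lemma dot_ge0 x y : dot y x = dot x y -> 0 <= ip y x -> 0 <= dot y x.
Proof.
rewrite [dot x y]dotC /ip; case: (dot y x) => p q /= [].
by rewrite lecE /= => e ->; rewrite andbT; apply/eqP; lra.
Qed.

Lemma dot_ext x y : (forall w, dot x w = dot y w) -> x = y.
Proof. by move=> h; apply: ip_ext => w; rewrite /ip h. Qed.

Ltac vec := apply: dot_ext => ?; rewrite ?(dotDl, dotZl, dotNl, dot0l); try ring.

Lemma ip_le x y : ip x y <= rn x * rn y.
Proof.
have [->|x0] := eqVneq x 0; first by rewrite ip0l rn0 mul0r.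
have p0 : 0 < rn x.
  by rewrite lt_def rn_ge0 andbT; apply: contra x0 => /eqP/rn_eq0 ->.
have := ip_ge0 ((rn y)%:C *: x - (rn x)%:C *: y).
rewrite !ipE -!rn2 (ipC y x).
have := rn_ge0 y; rewrite le_eqVlt => /orP[/eqP h|q0].
  by rewrite -h (rn_eq0 (esym h)) ip0r mulr0.
by have pq := mulr_gt0 p0 q0; move=> h; rewrite -(ler_pM2l pq); nra.
Qed.

Lemma ip_abs x y : `|ip x y| <= rn x * rn y.
Proof. by rewrite ler_norml ip_le andbT lerNl -ipNl -(rnN x) ip_le. Qed.

(** * Limits and orthogonal projections *)

Definition tends (u : nat -> H) (l : H) : Prop :=
  forall e : R, 0 < e -> exists N, forall n, (N <= n)%N -> rn (u n - l) < e.

Definition invS (n : nat) : R := n.+1%:R^-1.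

Lemma invS_gt0 n : 0 < invS n.
Proof. by rewrite invr_gt0. Qed.

Lemma invS_small (e : R) : 0 < e -> exists N, forall n, (N <= n)%N -> invS n < e.
Proof.
move=> e0; exists (Num.trunc e^-1) => n hn.
have ei : 0 < e^-1 by rewrite invr_gt0.
rewrite /invS invf_plt ?posrE//; apply: lt_le_trans (truncnS_gt _) _.
by rewrite ler_nat.
Qed.

Lemma tends_complete (u : nat -> H) :
  (forall e : R, 0 < e -> exists N, forall m n, (N <= m)%N -> (N <= n)%N ->
     rn (u m - u n) < e) ->
  exists l, tends u l.
Proof.
move=> h.
have : cvg (u @ \oo).
  apply: cauchy_cvg; apply/cauchy_ballP => e e0.
  have eE : e = (complex.Re e)%:C by rewrite RRe_real// gtr0_real.
  have e0' : 0 < complex.Re e by rewrite -ltcR -eE.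
  have [N hN] := h _ e0'.
  pose A := u @` [set n | (N <= n)%N].
  exists (A, A) => /=.
    by split; exists N => // n hn; exists n.
  case=> _ _ /= [[m hm <-] [n hn <-]].
  by rewrite -ball_normE /= normE eE ltcR hN.
move=> /cvg_ex[l hl]; exists l => e e0.
have e0' : 0 < e%:C by rewrite ltcR.
move/cvgrPdist_lt : hl => /(_ _ e0')[N _ hN]; exists N => n hn.
by have := hN n hn; rewrite /= normE ltcR rn_sub.
Qed.

Lemma tends_const x : tends (fun=> x) x.
Proof. by move=> e e0; exists 0%N => n _; rewrite subrr rn0. Qed.

Definition clo (K : set H) : set H :=
  [set x | forall e : R, 0 < e -> exists2 y, K y & rn (x - y) < e].

Lemma sub_clo (K : set H) : K `<=` clo K.
Proof. by move=> x Kx e e0; exists x => //; rewrite subrr rn0. Qed.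

Definition subspace (V : lmodType R[i]) (K : set V) : Prop :=
  K 0 /\ forall a (x y : V), K x -> K y -> K (a *: x + y).

Lemma subspaceD (V : lmodType R[i]) (K : set V) (x y : V) :
  subspace K -> K x -> K y -> K (x + y).
Proof. by case=> _ h hx hy; rewrite -[x]scale1r; exact: h. Qed.

Lemma subspaceZ (V : lmodType R[i]) (K : set V) a (x : V) :
  subspace K -> K x -> K (a *: x).
Proof. by case=> h0 h hx; rewrite -[_ *: x]addr0; exact: h. Qed.

Lemma subspaceB (V : lmodType R[i]) (K : set V) (x y : V) :
  subspace K -> K x -> K y -> K (x - y).
Proof.
by move=> h hx hy; rewrite addrC -scaleN1r; case: h => _; exact.
Qed.

(** Take [y] whose squared distance to [x] exceeds the infimum by less than d^2. The best step along
    [k] lowers that squared distance by <x - y, k>^2 / <k, k>, which therefore stays below d^2. *)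
Lemma near_projection (K : set H) x (d : R) : subspace K -> 0 < d ->
  exists2 y, K y & forall k, K k -> `|ip (x - y) k| <= d * rn k.
Proof.
move=> sK d0; pose A := [set r : R | exists2 y, K y & r = ip (x - y) (x - y)].
have hA : has_inf A.
  split; first by exists (ip (x - 0) (x - 0)); exists 0 => //; exact: sK.1.
  by exists 0 => r [y _ ->]; exact: ip_ge0.
have d2 : 0 < d ^+ 2 by rewrite exprn_gt0.
have [r [y Ky ->] hr] := inf_adherent d2 hA.
exists y => // k Kk.
have [->|k0] := eqVneq k 0; first by rewrite ip0r rn0 mulr0 normr0.
have kk : 0 < ip k k.
  by rewrite lt_def ip_ge0 andbT; apply: contra k0 => /eqP/ip_eq0 ->.
rewrite -ler_sqr ?nnegrE ?mulr_ge0 ?rn_ge0 ?(ltW d0)// real_normK ?num_real//.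
rewrite exprMn rn2; set s := ip (x - y) k; pose t := s / ip k k.
have hy' : K (y + t%:C *: k) by apply: subspaceD => //; exact: subspaceZ.
have : inf A <= ip (x - (y + t%:C *: k)) (x - (y + t%:C *: k)).
  by apply: inf_lbound; [exact: hA.2|exists (y + t%:C *: k)].
have -> : x - (y + t%:C *: k) = (x - y) - t%:C *: k by rewrite opprD addrA.
rewrite ipDl (ipDr (x - y)) (ipDr (- _)) !ipNl !ipNr !ipZl !ipZr (ipC k) -/s.
have tk : t * ip k k = s by rewrite /t divfK// gt_eqF.
have st : t * s * ip k k = s ^+ 2 by rewrite mulrAC tk.
move=> h1; have h2 : t * s <= d ^+ 2.
  have : t * (t * ip k k) = t * s by rewrite tk.
  by move: hr h1; rewrite -/s; nra.
by rewrite -st ler_wpM2r// ltW.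
Qed.

(** [K] need not be closed: the near projections [u n] are Cauchy, because [u m - u n] lies in [K]
    and can be tested against both residues, and their limit lies in the closure. *)
Lemma projection_exists (K : set H) x : subspace K ->
  exists2 p, clo K p & forall k, K k -> ip (x - p) k = 0.
Proof.
move=> sK.
have /choice[u hu] n : exists y,
    K y /\ forall k, K k -> `|ip (x - y) k| <= invS n * rn k.
  by have [y Ky hy] := near_projection x sK (invS_gt0 n); exists y.
have dist m n : rn (u m - u n) <= invS m + invS n.
  have Kd : K (u m - u n) by apply: subspaceB => //; [exact: (hu m).1|exact: (hu n).1].
  have := (hu m).2 _ Kd; have := (hu n).2 _ Kd; rewrite !ler_norml.
  move=> /andP[_ h1] /andP[h2 _].
  have e2 : rn (u m - u n) ^+ 2 <= (invS m + invS n) * rn (u m - u n).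
    rewrite rn2 [X in X <= _](_ : _ =
      ip (x - u n) (u m - u n) - ip (x - u m) (u m - u n)); last first.
      by rewrite !ipE; ring.
    by rewrite mulrDl; lra.
  have := rn_ge0 (u m - u n); rewrite le_eqVlt => /orP[/eqP <-|p0].
    by rewrite addr_ge0// ltW// invS_gt0.
  by rewrite expr2 ler_pM2r in e2.
have [|p hp] := @tends_complete u.
  move=> e e0; have e2 : 0 < e / 2 by rewrite divr_gt0.
  have [N hN] := invS_small e2; exists N => m n hm hn.
  by apply: le_lt_trans (dist m n) _; have := hN m hm; have := hN n hn; lra.
exists p.
  move=> e /hp[N hN]; exists (u N); first exact: (hu N).1.
  by rewrite rn_sub hN.
move=> k Kk; apply/eqP; rewrite -normr_eq0 eq_le normr_ge0 andbT.
apply/ler_addgt0Pr => e e0; rewrite add0r.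
pose d := e / 2 / (1 + rn k).
have k1 : 0 < 1 + rn k by have := rn_ge0 k; lra.
have d0 : 0 < d by rewrite !divr_gt0.
have dk : d * (1 + rn k) = e / 2 by rewrite /d divfK// gt_eqF.
have [N1 h1] := hp _ d0; have [N2 h2] := invS_small d0.
pose n := maxn N1 N2; have {}h1 := h1 n (leq_maxl _ _); have {}h2 := h2 n (leq_maxr _ _).
have -> : ip (x - p) k = ip (x - u n) k + ip (u n - p) k by rewrite !ipE; ring.
apply: le_trans (ler_normD _ _) _.
have := (hu n).2 _ Kk; have := ip_abs (u n - p) k; have := rn_ge0 k.
by move=> *; nra.
Qed.

(** * Bounded operators *)

Definition lin (f : H -> H) : Prop :=
  forall a x y, f (a *: x + y) = a *: f x + f y.

Definition bdd (f : H -> H) : Prop :=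
  exists2 c : R, 0 < c & forall x, rn (f x) <= c * rn x.

(** The real part suffices: as the imaginary part of [dot x y] is [ip x ('i *: y)], linearity of [g]
    recovers the complex identity in [dot_adj]. *)
Definition adj (f g : H -> H) : Prop := forall x y, ip (f x) y = ip x (g y).

Lemma linD f x y : lin f -> f (x + y) = f x + f y.
Proof. by move=> lf; have := lf 1 x y; rewrite !scale1r. Qed.

Lemma lin0 f : lin f -> f 0 = 0.
Proof. by move=> lf; apply: (addrI (f 0)); rewrite -linD// !addr0. Qed.

Lemma linZ f a x : lin f -> f (a *: x) = a *: f x.
Proof. by move=> lf; rewrite -[a *: x]addr0 lf (lin0 lf) addr0. Qed.

Lemma linN f x : lin f -> f (- x) = - f x.
Proof. by move=> lf; rewrite -scaleN1r linZ// scaleN1r. Qed.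

Lemma linB f x y : lin f -> f (x - y) = f x - f y.
Proof. by move=> lf; rewrite linD// linN. Qed.

Lemma lin_id : lin idfun.
Proof. by []. Qed.

Lemma lin_cst0 : lin (fun=> 0).
Proof. by move=> a x y; rewrite scaler0 addr0. Qed.

Lemma lin_comp f g : lin f -> lin g -> lin (f \o g).
Proof. by move=> lf lg a x y /=; rewrite lg lf. Qed.

Lemma lin_add f g : lin f -> lin g -> lin (fun x => f x + g x).
Proof. by move=> lf lg a x y /=; rewrite lg lf; vec. Qed.

Lemma lin_scale b f : lin f -> lin (fun x => b *: f x).
Proof. by move=> lf a x y /=; rewrite lf; vec. Qed.

Lemma lin_opp f : lin f -> lin (fun x => - f x).
Proof. by move=> lf a x y /=; rewrite lf; vec. Qed.

Lemma lin_sub f g : lin f -> lin g -> lin (fun x => f x - g x).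
Proof. by move=> lf lg; apply: lin_add => //; exact: lin_opp. Qed.

Lemma bdd_id : bdd idfun.
Proof. by exists 1 => // x; rewrite mul1r. Qed.

Lemma bdd_cst0 : bdd (fun=> 0).
Proof. by exists 1 => // x; rewrite mul1r rn0 rn_ge0. Qed.

Lemma bdd_comp f g : bdd f -> bdd g -> bdd (f \o g).
Proof.
move=> [c c0 hc] [d d0 hd]; exists (c * d); first exact: mulr_gt0.
by move=> x /=; apply: le_trans (hc _) _; rewrite -mulrA ler_pM2l.
Qed.

Lemma bdd_add f g : bdd f -> bdd g -> bdd (fun x => f x + g x).
Proof.
move=> [c c0 hc] [d d0 hd]; exists (c + d); first exact: addr_gt0.
by move=> x /=; apply: le_trans (rnD _ _) _; rewrite mulrDl lerD.
Qed.

Lemma bdd_scale b f : bdd f -> bdd (fun x => b *: f x).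
Proof.
move=> [c c0 hc]; exists ((complex.Re `|b| + 1) * c).
  by rewrite mulr_gt0// ltr_wpDl// nc_ge0.
move=> x; rewrite rnZ; have := nc_ge0 b; have := hc x; have := rn_ge0 (f x).
by move=> *; nra.
Qed.

Lemma bdd_opp f : bdd f -> bdd (fun x => - f x).
Proof. by move=> [c c0 hc]; exists c => // x; rewrite rnN. Qed.

Lemma bdd_sub f g : bdd f -> bdd g -> bdd (fun x => f x - g x).
Proof. by move=> bf bg; apply: bdd_add => //; exact: bdd_opp. Qed.

Lemma adjC f g : adj f g -> adj g f.
Proof. by move=> h x y; rewrite ipC -h ipC. Qed.

Lemma adj_comp f f' g g' : adj f f' -> adj g g' -> adj (f \o g) (g' \o f').
Proof. by move=> hf hg x y /=; rewrite hf hg. Qed.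

Lemma adj_add f f' g g' : adj f f' -> adj g g' ->
  adj (fun x => f x + g x) (fun x => f' x + g' x).
Proof. by move=> hf hg x y /=; rewrite ipDl ipDr hf hg. Qed.

Lemma adj_opp f f' : adj f f' -> adj (fun x => - f x) (fun x => - f' x).
Proof. by move=> hf x y /=; rewrite ipNl ipNr hf. Qed.

Lemma adj_sub f f' g g' : adj f f' -> adj g g' ->
  adj (fun x => f x - g x) (fun x => f' x - g' x).
Proof. by move=> hf hg; apply: adj_add => //; exact: adj_opp. Qed.

Lemma adj_real (c : R) f f' : adj f f' ->
  adj (fun x => c%:C *: f x) (fun x => c%:C *: f' x).
Proof. by move=> hf x y /=; rewrite ipZl ipZr hf. Qed.

Lemma dot_adj f g : lin g -> adj f g -> forall x y, dot (f x) y = dot x (g y).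
Proof. by move=> lg h x y; rewrite !dotE -(linZ _ _ lg) !h. Qed.

Lemma lin_adj f g : lin f -> adj f g -> lin g.
Proof.
move=> lf h a x y; apply: dot_ext => w; have e := dot_adj lf (adjC h).
by rewrite e !dotDl !dotZl !e.
Qed.

Lemma clo_map K f x : lin f -> bdd f -> clo K x -> clo (f @` K) (f x).
Proof.
move=> lf [c c0 hc] hx e e0.
have [y Ky hy] := hx (e / c) (divr_gt0 e0 c0); exists (f y); first by exists y.
by rewrite -linB//; apply: le_lt_trans (hc _) _; rewrite mulrC -ltr_pdivlMr.
Qed.

Lemma clo_orth K x w : (forall k, K k -> ip k w = 0) -> clo K x -> ip x w = 0.
Proof.
move=> h hx; apply/eqP; rewrite -normr_eq0 eq_le normr_ge0 andbT.
apply/ler_addgt0Pr => e e0; rewrite add0r.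
have k1 : 0 < 1 + rn w by have := rn_ge0 w; lra.
have [k Kk hk] := hx (e / (1 + rn w)) (divr_gt0 e0 k1).
have -> : ip x w = ip (x - k) w by rewrite ipDl ipNl (h k)// subr0.
apply: le_trans (ip_abs _ _) _; move: hk; rewrite ltr_pdivlMr//.
by have := rn_ge0 w; have := rn_ge0 (x - k); nra.
Qed.

Lemma clo_eq0 K f x : lin f -> bdd f -> (forall k, K k -> f k = 0) ->
  clo K x -> f x = 0.
Proof.
move=> lf bf h /(clo_map lf bf) hx; apply: ip_eq0.
by apply: clo_orth hx => _ [k Kk <-]; rewrite h// ip0l.
Qed.

Lemma clo_eq K f g x : lin f -> bdd f -> lin g -> bdd g ->
  (forall k, K k -> f k = g k) -> clo K x -> f x = g x.
Proof.
move=> lf bf lg bg h hx; apply/eqP; rewrite -subr_eq0; apply/eqP.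
apply: (clo_eq0 (lin_sub lf lg) (bdd_sub bf bg) _ hx) => k Kk.
by rewrite h// subrr.
Qed.

Lemma adjoint_exists g : lin g -> bdd g -> exists2 g', lin g' & bdd g' /\ adj g g'.
Proof.
move=> lg bg.
have /choice[g' hg'] y : exists z, forall x, dot (g x) y = dot x z.
  have [h0|/existsNP[x0 hx0]] := pselect (forall x, dot (g x) y = 0).
    by exists 0 => x; rewrite h0 linear0r.
  (* Riesz representation of the functional x |-> <g x, y>: it is determined by its kernel [K] and
     by its value at [w], the component of [x0] orthogonal to [K]. *)
  pose K := [set x | dot (g x) y = 0].
  have sK : subspace K.
    split=> [|a u v]; rewrite /K /= ?lin0 ?dot0l// => hu hv.
    by rewrite lg dotDl dotZl hu hv mulr0 addr0.
  have [p hp ort] := projection_exists x0 sK.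
  have Kp : dot (g p) y = 0.
    have hgp := clo_map lg bg hp.
    have h w : (w = y \/ w = 'i *: y) -> ip (g p) w = 0.
      move=> hw; apply: clo_orth hgp => _ [k Kk <-].
      by move: Kk; rewrite /K /= dotE => -[]; case: hw => ->.
    by rewrite dotE !h; [|right|left].
  pose w := x0 - p.
  have gw : dot (g w) y = dot (g x0) y by rewrite linB// dotDl dotNl Kp subr0.
  have gw0 : dot (g w) y != 0 by rewrite gw; apply/eqP.
  have ww0 : dot w w != 0.
    apply: contraNneq gw0 => e; have /ip_eq0 -> : ip w w = 0 by rewrite /ip e.
    by rewrite lin0// dot0l.
  exists ((dot (g w) y / dot w w)^*%C *: w) => x.
  rewrite dotZr conjcK.
  pose k := x - (dot (g x) y / dot (g w) y) *: w.
  have Kk : K k by rewrite /K /= linB// linZ// dotDl dotNl dotZl divfK// subrr.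
  have : dot w k = 0.
    rewrite dotE ort// ort//; exact: subspaceZ.
  rewrite dotC => /(congr1 (@conjc R)); rewrite conjcK conjc0 /k dotDl dotNl dotZl.
  by move=> /eqP; rewrite subr_eq0 => /eqP ->; field; rewrite gw0 ww0.
have ag : adj g g' by move=> x y; rewrite /ip hg'.
have lg' : lin g'.
  exact: lin_adj lg ag.
exists g' => //; split => //.
have [c c0 hc] := bg; exists c => // y.
have := ag (g' y) y; rewrite -rn2; have := ip_le (g (g' y)) y.
have := hc (g' y); have := rn_ge0 (g' y); have := rn_ge0 y.
rewrite le_eqVlt => /orP[/eqP <-|y0]; rewrite ?mulr0; first by move=> *; nra.
by rewrite le_eqVlt => /orP[/eqP <-|g0]; [rewrite mulr_ge0// ltW|nra].
Qed.

Lemma tends_uniq u l k : tends u l -> tends u k -> l = k.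
Proof.
move=> hl hk; apply/eqP; rewrite -subr_eq0; apply/eqP/rn_small => e e0.
have e2 : 0 < e / 2 by rewrite divr_gt0.
have [N1 h1] := hl _ e2; have [N2 h2] := hk _ e2.
have := h1 _ (leq_maxl N1 N2); have := h2 _ (leq_maxr N1 N2).
set n := maxn _ _; rewrite rn_sub => a b.
have -> : l - k = - (u n - l) + (u n - k) by vec.
by apply: le_trans (rnD _ _) _; rewrite rnN (rn_sub _ k); lra.
Qed.

Lemma tends_dominated (u v : nat -> H) l k (c : R) : tends u l -> 0 < c ->
  (forall n, rn (v n - k) <= c * rn (u n - l)) -> tends v k.
Proof.
move=> hu c0 h e e0; have [N hN] := hu _ (divr_gt0 e0 c0); exists N => n hn.
by apply: le_lt_trans (h n) _; rewrite mulrC -ltr_pdivlMr// hN.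
Qed.

Lemma tends_map f u l : lin f -> bdd f -> tends u l -> tends (f \o u) (f l).
Proof.
move=> lf [c c0 hc] hu; apply: (tends_dominated hu c0) => n /=.
by rewrite -linB.
Qed.

Lemma tendsD u v l k : tends u l -> tends v k -> tends (fun n => u n + v n) (l + k).
Proof.
move=> hl hk e e0; have e2 : 0 < e / 2 by rewrite divr_gt0.
have [N1 h1] := hl _ e2; have [N2 h2] := hk _ e2.
exists (maxn N1 N2) => n; rewrite geq_max => /andP[/h1 a /h2 b].
have -> : u n + v n - (l + k) = (u n - l) + (v n - k) by vec.
by apply: le_lt_trans (rnD _ _) _; lra.
Qed.

Lemma tendsZ a u l : tends u l -> tends (fun n => a *: u n) (a *: l).
Proof.
have lf : lin (fun x => a *: x) by apply: lin_scale lin_id.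
by apply: (tends_map lf); exact: (@bdd_scale a idfun bdd_id).
Qed.

Lemma tends_bound u l (c : R) : tends u l -> (forall n, rn (u n) <= c) -> rn l <= c.
Proof.
move=> hu h; apply/ler_addgt0Pr => e e0; have [N hN] := hu _ e0.
have -> : l = u N - (u N - l) by vec.
apply: le_trans (rnB _ _) _; have := hN N (leqnn _); have := h N; lra.
Qed.

Lemma tends_ip u v l k a b : tends u l -> tends v k ->
  (forall n, ip (u n) a = ip b (v n)) -> ip l a = ip b k.
Proof.
move=> hu hv h; apply/eqP; rewrite -subr_eq0 -normr_eq0 eq_le normr_ge0 andbT.
apply/ler_addgt0Pr => e e0; rewrite add0r.
pose c := 1 + rn a + rn b.
have c0 : 0 < c by rewrite /c; have := rn_ge0 a; have := rn_ge0 b; lra.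
have ec := divr_gt0 e0 c0.
have [N1 h1] := hu _ ec; have [N2 h2] := hv _ ec.
have := h1 _ (leq_maxl N1 N2); have := h2 _ (leq_maxr N1 N2).
set n := maxn _ _; move=> h3 h4.
have -> : ip l a - ip b k = ip b (v n - k) - ip (u n - l) a.
  by rewrite !ipE h; ring.
apply: le_trans (ler_normB _ _) _.
have := ip_abs b (v n - k); have := ip_abs (u n - l) a.
have ee : e = (e / c) * (1 + rn a + rn b) by rewrite divfK// gt_eqF.
by have := rn_ge0 a; have := rn_ge0 b; rewrite [X in _ -> _ -> _ <= X]ee; nra.
Qed.

(** * Square roots *)

Section SquareRoot.
Variable X : H -> H.
Hypotheses (lX : lin X) (cX : forall x, rn (X x) <= rn x) (aX : adj X X).

(* The iteration [y_(n+1) = (1 + y_n^2) / 2], whose limit [y] solves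
   [(1 - y)^2 = 0], bounds in norm the iteration
   [Y_(n+1) = (X + Y_n^2) / 2], whose limit [Y] solves [(1 - Y)^2 = 1 - X]. *)
Fixpoint majorant n : R := if n is m.+1 then (1 + majorant m ^+ 2) / 2 else 0.

Fixpoint sqrt_iter n : H -> H :=
  if n is m.+1
  then fun x => (2^-1 : R)%:C *: (X x + sqrt_iter m (sqrt_iter m x)) else fun=> 0.

Let majP n : [/\ 0 <= majorant n, majorant n <= majorant n.+1 & majorant n <= 1].
Proof.
elim: n => [|n [h0 h1 h2]]; first by rewrite /= expr2; split; lra.
move: h1; rewrite [majorant n.+2]/= [majorant n.+1]/=.
set a := majorant n in h0 h2 *; move=> h1; split; nra.
Qed.

Let linY n : lin (sqrt_iter n).
Proof.
elim: n => [|n ih]; first exact: lin_cst0.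
by apply: lin_scale; apply: lin_add lX _; exact: lin_comp.
Qed.

Let cY n x : rn (sqrt_iter n x) <= majorant n * rn x.
Proof.
elim: n x => [|n ih] x; first by rewrite /= rn0 mul0r.
rewrite /= rnZC ger0_norm ?invr_ge0//.
have := rnD (X x) (sqrt_iter n (sqrt_iter n x)); have := cX x.
have := ih (sqrt_iter n x); have := ih x; have [h0 _ h2] := majP n.
have : majorant n * rn (sqrt_iter n x) <= majorant n * (majorant n * rn x).
  by rewrite ler_wpM2l.
by lra.
Qed.

Let adjY n : adj (sqrt_iter n) (sqrt_iter n).
Proof.
elim: n => [|n ih]; first by move=> x y; rewrite ip0l ip0r.
by apply: adj_real; apply: adj_add aX _; exact: adj_comp.
Qed.

Let commY n f : lin f -> (forall x, f (X x) = X (f x)) ->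
  forall x, f (sqrt_iter n x) = sqrt_iter n (f x).
Proof.
move=> lf hf; elim: n => [|n ih] x; first by rewrite lin0.
by rewrite /= linZ// linD// !ih hf.
Qed.

(** With Z = Y_(n+1) and W = Y_n, the splitting Z^2 - W^2 = Z (Z - W) + (Z - W) W mirrors b^2 - a^2
    = b (b - a) + (b - a) a for the majorants, so the bounds propagate term by term. *)
Let incrY n x :
  rn (sqrt_iter n.+1 x - sqrt_iter n x) <= (majorant n.+1 - majorant n) * rn x.
Proof.
elim: n x => [|n ih] x; first by rewrite !subr0; exact: cY.
set Z := sqrt_iter n.+1; set W := sqrt_iter n.
have -> : sqrt_iter n.+2 x - Z x =
    (2^-1 : R)%:C *: (Z (Z x - W x) + (Z (W x) - W (W x))).
  rewrite (linB _ _ (linY n.+1 : lin Z)) -[LHS]/(_ *: _ - _ *: _) -scalerBr.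
  by congr (_ *: _); vec.
rewrite rnZC ger0_norm ?invr_ge0//.
have := rnD (Z (Z x - W x)) (Z (W x) - W (W x)).
have := ih (W x); have := ih x; rewrite -/Z -/W.
have := cY n.+1 (Z x - W x); have := cY n x; rewrite -/Z -/W.
have [a0 a1 a2] := majP n; have [b0 b1 b2] := majP n.+1.
have -> : majorant n.+2 = (1 + majorant n.+1 ^+ 2) / 2 by [].
have e : majorant n.+1 = (1 + majorant n ^+ 2) / 2 by [].
set a := majorant n in a0 a1 a2 e *; set b := majorant n.+1 in a1 b0 b1 b2 e *.
move=> h1 h2 h3 h4 h5.
have h6 : b * rn (Z x - W x) <= b * ((b - a) * rn x) by rewrite ler_wpM2l.
have h7 : (b - a) * rn (W x) <= (b - a) * (a * rn x) by rewrite ler_wpM2l ?subr_ge0.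
have -> : ((1 + b ^+ 2) / 2 - b) * rn x =
    2^-1 * (b * ((b - a) * rn x) + (b - a) * (a * rn x)) by rewrite {2}e; field.
by rewrite ler_pM2l ?invr_gt0//; lra.
Qed.

Let distY m n x : (m <= n)%N ->
  rn (sqrt_iter n x - sqrt_iter m x) <= (majorant n - majorant m) * rn x.
Proof.
move=> /subnK <-; elim: (n - m)%N => [|k ih]; first by rewrite !subrr rn0 mul0r.
rewrite addSn.
have -> : sqrt_iter (k + m).+1 x - sqrt_iter m x =
  (sqrt_iter (k + m).+1 x - sqrt_iter (k + m) x) + (sqrt_iter (k + m) x - sqrt_iter m x).
  by vec.
by apply: le_trans (rnD _ _) _; have := incrY (k + m) x; lra.
Qed.

Let maj_cauchy (e : R) : 0 < e ->
  exists N, forall m, (N <= m)%N -> `|majorant m - majorant N| < e.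
Proof.
move=> e0; have hs : has_sup (range majorant).
  split; first by exists (majorant 0), 0%N.
  by exists 1 => _ [n _ <-]; have [] := majP n.
have [_ [N _ <-] hN] := sup_adherent e0 hs; exists N => m hm.
have mono : majorant N <= majorant m.
  move: hm => /subnK <-; elim: (m - N)%N => // k ih; rewrite addSn.
  by apply: le_trans ih _; have [] := majP (k + N).
have : majorant m <= sup (range majorant) by apply: sup_ubound; [exact: hs.2|exists m].
by rewrite ger0_norm ?subr_ge0//; lra.
Qed.

Lemma sqrt_exists : exists T,
  [/\ lin T, bdd T, adj T T, forall x, T (T x) = x - X x &
   (forall x, 0 <= ip (T x) x) /\
   forall f, lin f -> bdd f -> (forall x, f (X x) = X (f x)) ->
     forall x, f (T x) = T (f x)].
Proof.
have /choice[Y hY] x : exists l, tends (fun n => sqrt_iter n x) l.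
  apply: tends_complete => e e0.
  have x1 : 0 < 1 + rn x by have := rn_ge0 x; lra.
  have [N hN] := maj_cauchy (divr_gt0 (divr_gt0 e0 (ltr0n R 2)) x1).
  have h m : (N <= m)%N -> rn (sqrt_iter m x - sqrt_iter N x) < e / 2.
    move=> hm; apply: le_lt_trans (distY x hm) _.
    have := hN m hm; rewrite ltr_pdivlMr//.
    have := ler_norm (majorant m - majorant N); have := rn_ge0 x.
    by have := normr_ge0 (majorant m - majorant N); nra.
  exists N => m n /h hm /h hn.
  have -> : sqrt_iter m x - sqrt_iter n x =
    (sqrt_iter m x - sqrt_iter N x) - (sqrt_iter n x - sqrt_iter N x) by vec.
  by apply: le_lt_trans (rnB _ _) _; lra.
have lY : lin Y.
  move=> a x y; apply: (tends_uniq (hY _)).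
  have h := tendsD (tendsZ a (hY x)) (hY y).
  by apply: (tends_dominated h ltr01) => n; rewrite linY mul1r.
have cYn n x : rn (sqrt_iter n x) <= rn x.
  by have := cY n x; have [_ _] := majP n; have := rn_ge0 x; nra.
have cYx x : rn (Y x) <= rn x by exact: (tends_bound (hY x)).
have bY : bdd Y by exists 1 => // x; rewrite mul1r.
have aY : adj Y Y.
  by move=> x y; apply: (tends_ip (hY x) (hY y)) => n; exact: adjY.
have eY x : Y x = (2^-1 : R)%:C *: (X x + Y (Y x)).
  apply: (tends_uniq (u := fun n => sqrt_iter n.+1 x)).
    by move=> e /(hY x)[N hN]; exists N => n hn; apply: hN; exact: leqW.
  apply: tendsZ; apply: tendsD; first exact: tends_const.
  move=> e e0; have e2 : 0 < e / 2 by rewrite divr_gt0.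
  have [N1 h1] := hY x _ e2; have [N2 h2] := hY (Y x) _ e2.
  exists (maxn N1 N2) => n; rewrite geq_max => /andP[/h1 a /h2 b].
  have -> : sqrt_iter n (sqrt_iter n x) - Y (Y x) =
    sqrt_iter n (sqrt_iter n x - Y x) + (sqrt_iter n (Y x) - Y (Y x)).
    by rewrite (linB _ _ (linY n)); vec.
  by apply: le_lt_trans (rnD _ _) _; have := cYn n (sqrt_iter n x - Y x); lra.
exists (fun x => x - Y x); split.
- exact: lin_sub lin_id lY.
- exact: bdd_sub bdd_id bY.
- by apply: adj_sub.
- move=> x; rewrite (linB _ _ lY).
  have : Y x + Y x = X x + Y (Y x).
    by rewrite {1 2}eY; apply: ip_ext => w; rewrite ipDl ipZl; field.
  move=> h; apply: ip_ext => w; move/(congr1 (ip^~ w)): h.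
  by rewrite !ipE; lra.
split.
- move=> x; rewrite ipDl ipNl subr_ge0 -rn2.
  by have := ip_le (Y x) x; have := cYx x; have := rn_ge0 x; nra.
- move=> f lf bf hf x; rewrite (linB _ _ lf); congr (_ - _).
  apply: (tends_uniq (tends_map lf bf (hY x))).
  apply: (tends_dominated (hY (f x)) ltr01) => n /=.
  by rewrite mul1r (commY _ lf hf).
Qed.

End SquareRoot.

(** * Absolute values and projections onto closed subspaces *)

Lemma contraction_adj B B' : adj B B' -> (forall x, rn (B x) <= rn x) ->
  forall x, rn (B' x) <= rn x.
Proof.
move=> aB cB x.
have := aB (B' x) x; rewrite -rn2; have := ip_le (B (B' x)) x.
have := cB (B' x); have := rn_ge0 (B' x); have := rn_ge0 x.
rewrite le_eqVlt => /orP[/eqP <-|x0]; rewrite ?mulr0; first by move=> *; nra.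
by rewrite le_eqVlt => /orP[/eqP <-|g0]; [move=> *; rewrite ltW|nra].
Qed.

(** [T] is |B|, the square root of 1 - X for X = 1 - B' B. Here X is a contraction because |X x|^2 =
    |x|^2 - 2 |B x|^2 + |B' B x|^2 and |B' B x| <= |B x|. *)
Lemma abs_exists B B' : lin B -> adj B B' -> (forall x, rn (B x) <= rn x) ->
  exists T,
  [/\ lin T, bdd T, adj T T, forall x, T (T x) = B' (B x) &
   (forall x, 0 <= ip (T x) x) /\
   forall f, lin f -> bdd f -> (forall x, f (B' (B x)) = B' (B (f x))) ->
     forall x, f (T x) = T (f x)].
Proof.
move=> lB aB cB; have lB' := lin_adj lB aB; have cB' := contraction_adj aB cB.
pose X x := x - B' (B x).
have lX : lin X by exact: lin_sub lin_id (lin_comp lB' lB).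
have cX x : rn (X x) <= rn x.
  have e : ip x (B' (B x)) = ip (B x) (B x) by rewrite -aB.
  rewrite rn_le2 /X !ipE (ipC (B' (B x)) x) e.
  by have := cB' (B x); rewrite rn_le2; have := ip_ge0 (B x); lra.
have aX : adj X X.
  by move=> x y; rewrite /X !ipE -aB (ipC (B' _)) -aB (ipC (B y)).
have [T [lT bT aT T2 [T0 cT]]] := sqrt_exists lX cX aX.
exists T; split => //; first by move=> x; rewrite T2 /X subKr.
by split=> // f lf bf hf; apply: cT => // x; rewrite /X (linB _ _ lf) hf.
Qed.

Lemma conjc_i : ('i^*)%C = - 'i%C :> R[i].
Proof. by apply/eqP; rewrite eq_complex /= oppr0 !eqxx. Qed.

Lemma neq0Ci_complex : 'i%C != 0 :> R[i].
Proof. by rewrite eq_complex /= oner_eq0 andbF. Qed.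

Lemma ip_scale a x y : ip (a *: x) y = ip x (a^*%C *: y).
Proof. by rewrite /ip dotZl dotZr conjcK. Qed.

Lemma clo_sub (K L : set H) : K `<=` L -> clo K `<=` clo L.
Proof. by move=> h x hx e /hx[y /h Ly hy]; exists y. Qed.

Lemma clo_inv K f : lin f -> bdd f -> (forall k, K k -> K (f k)) ->
  forall x, clo K x -> clo K (f x).
Proof.
move=> lf bf h x /(clo_map lf bf); apply: clo_sub => _ [k Kk <-]; exact: h.
Qed.

Lemma clo_subspace K : subspace K -> subspace (clo K).
Proof.
move=> sK; split; first by apply: sub_clo; exact: sK.1.
move=> a x y hx hy e e0; pose c := 1 + complex.Re `|a|.
have c0 : 0 < c by rewrite /c; have := nc_ge0 a; lra.
have [u Ku hu] := hx _ (divr_gt0 (divr_gt0 e0 (ltr0n R 2)) c0).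
have [v Kv hv] := hy _ (divr_gt0 e0 (ltr0n R 2)).
exists (a *: u + v); first exact: sK.2.
have -> : a *: x + y - (a *: u + v) = a *: (x - u) + (y - v).
  by rewrite scalerBr; vec.
apply: le_lt_trans (rnD _ _) _; rewrite rnZ.
move: hu; rewrite ltr_pdivlMr// /c.
by have := nc_ge0 a; have := rn_ge0 (x - u); nra.
Qed.

Lemma clo_orth_eq0 K x : clo K x -> (forall k, K k -> ip x k = 0) -> x = 0.
Proof. by move=> hx h; apply: ip_eq0; apply: clo_orth hx => k /h; rewrite ipC. Qed.

(** For the commutation clause: f (p x) lies in the closure of [K] since [f] preserves [K], and f (x
    - p x) is orthogonal to [K] since [f'] does; the two facts characterize p (f x). *)
Lemma orth_projection K : subspace K -> exists p,
  [/\ lin p, bdd p, adj p p, (forall x, clo K (p x)) &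
   (forall k, K k -> p k = k) /\
   forall f f', lin f -> bdd f -> adj f f' ->
     (forall k, K k -> K (f k)) -> (forall k, K k -> K (f' k)) ->
     forall x, p (f x) = f (p x)].
Proof.
move=> sK; have scK := clo_subspace sK.
have /choice[p hp] x : exists q, clo K q /\ forall k, K k -> ip (x - q) k = 0.
  by have [q h1 h2] := projection_exists x sK; exists q.
have uniq x q : clo K q -> (forall k, K k -> ip (x - q) k = 0) -> p x = q.
  move=> hq ho; apply/eqP; rewrite -subr_eq0; apply/eqP/(@clo_orth_eq0 K).
    exact: (subspaceB scK (hp x).1 hq).
  move=> k Kk; have -> : p x - q = (x - q) - (x - p x) by vec.
  by rewrite ipDl ipNl ho// (hp x).2// subrr.
have lp : lin p.
  move=> a x y; apply: uniq; first by apply: scK.2; [exact: (hp x).1|exact: (hp y).1].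
  move=> k Kk; have -> : a *: x + y - (a *: p x + p y) = a *: (x - p x) + (y - p y).
    by rewrite scalerBr; vec.
  by rewrite ipDl ip_scale (hp x).2 ?(hp y).2 ?addr0//; exact: subspaceZ.
have ortc x y : ip (x - p x) (p y) = 0.
  by rewrite ipC; apply: clo_orth (hp y).1 => k Kk; rewrite ipC (hp x).2.
have ap : adj p p.
  move=> x y; have := ortc x y; have := ortc y x.
  by rewrite !ipDl !ipNl (ipC y) (ipC (p y)); lra.
exists p; split => //.
- exists 1 => // x; rewrite mul1r; have := ortc x x; rewrite ipDl ipNl -rn2.
  by have := ip_le x (p x); have := rn_ge0 x; have := rn_ge0 (p x); nra.
- by move=> x; exact: (hp x).1.
- split=> [k Kk|f f' lf bf ff' hf hf' x].
    by apply: uniq; [exact: sub_clo|move=> ? _; rewrite subrr ip0l].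
  apply: uniq; first by apply: clo_inv => //; exact: (hp x).1.
  by move=> k Kk; rewrite -linB// ff' (hp x).2//; exact: hf'.
Qed.

(** * Functions and graphs *)

Definition gr (f : H -> H) : oper H := [set p | p.2 = f p.1].

Lemma gr_inj f g : gr f = gr g -> f = g.
Proof.
move=> e; apply/funext => x; have : gr f (x, f x) by [].
by rewrite e.
Qed.

Lemma op1E : op1 H = gr idfun.
Proof. by []. Qed.

Lemma op0E : op0 H = gr (fun=> 0).
Proof. by []. Qed.

Lemma op_mulE f g : op_mul (gr f) (gr g) = gr (f \o g).
Proof.
rewrite /gr; apply/seteqP; split=> -[x y] /=; first by case=> z /= -> ->.
by move=> ->; exists (g x).
Qed.

Lemma op_addE f g : op_add (gr f) (gr g) = gr (fun x => f x + g x).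
Proof.
rewrite /gr; apply/seteqP; split=> -[x y] /=; first by case=> u [v /= [-> -> ->]].
by move=> ->; exists (f x), (g x).
Qed.

Lemma op_scaleE a f : op_scale a (gr f) = gr (fun x => a *: f x).
Proof.
rewrite /op_scale; case: eqP => [->|_].
  by rewrite op0E; congr gr; apply/funext => x; rewrite scale0r.
rewrite /gr; apply/seteqP; split=> -[x y] /=; first by case=> u /= -> ->.
by move=> ->; exists (f x).
Qed.

Lemma op_adjE f g : lin g -> adj f g -> op_adj dot (gr f) = gr g.
Proof.
move=> lg h; rewrite /op_adj /gr; apply/seteqP; split=> -[x y] /= e.
  apply: dot_ext => w; rewrite dotC -(e w (f w))// (dot_adj lg h).
  by rewrite -dotC.
by move=> u v /= ->; rewrite (dot_adj lg h) e.
Qed.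

Lemma op_adj_gr f g : op_adj dot (gr f) = gr g -> adj f g.
Proof.
move=> e x y; have : op_adj dot (gr f) (y, g y) by rewrite e.
by rewrite /op_adj /= /ip => /(_ x (f x) erefl) ->.
Qed.

Lemma linear_gr f : lin f -> linear_op (gr f).
Proof.
move=> lf; rewrite /gr; split => /=; first by move=> x y z -> ->.
  by rewrite lin0.
by move=> a x y x' y' -> ->.
Qed.

Lemma bounded_gr f : lin f -> bdd f -> bounded_op (gr f).
Proof.
move=> lf [c c0 hc]; split; first exact: linear_gr.
  by apply/seteqP; split => // x _; exists (f x).
exists c%:C => x y; rewrite /gr /= => ->; rewrite !normE -rmorphM lecR; exact: hc.
Qed.

Lemma bounded_opE T : bounded_op T -> exists f, [/\ lin f, bdd f & T = gr f].
Proof.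
move=> [[Tf T0 TL] Td [c hc]].
have /choice[f hf] x : exists y, T (x, y).
  by have : dom T x by rewrite Td.
have e : T = gr f.
  apply/seteqP; split=> -[x y] /=; first by move=> h; exact: Tf h (hf x).
  by rewrite /gr /= => ->; exact: hf.
exists f; split => //.
  move=> a x y; apply: (Tf (a *: x + y)); first exact: hf.
  by apply: TL; exact: hf.
(* The bound in [bounded_op] is a complex number whose real part governs the norms; adding 1 gives
   the strictly positive constant that [bdd] asks for. *)
exists (1 + `|complex.Re c|); first by have := normr_ge0 (complex.Re c); lra.
move=> x; have := hc x _ (hf x); rewrite !normE lecE => /andP[_ /=].
rewrite -[X in _ <= complex.Re X -> _]/(c * (rn x)%:C).
have -> : complex.Re (c * (rn x)%:C) = complex.Re c * rn x.
  by case: c {hc} => a b /=; rewrite mulr0 subr0.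
have := ler_norm (complex.Re c); have := rn_ge0 x; nra.
Qed.

Lemma closedE (T : set (H * H)) : closed T <->
  forall x y, (forall e : R, 0 < e ->
    exists a b, [/\ T (a, b), rn (x - a) < e & rn (y - b) < e]) -> T (x, y).
Proof.
split=> [cT x y h|h [x y] hcl].
  apply: cT => B /nbhs_ballP[e /= e0 hB].
  have eE : e = (complex.Re e)%:C by rewrite RRe_real// gtr0_real.
  have e0' : 0 < complex.Re e by rewrite -ltcR -eE.
  have [a [b [Tab ha hb]]] := h _ e0'.
  exists (a, b); split => //; apply: hB.
  by split; rewrite /= -ball_normE /= normE eE ltcR.
apply: h => e e0; have e0' : 0 < e%:C by rewrite ltcR.
have [[a b] [Tab [/= ha hb]]] := hcl _ (nbhsx_ballx (x, y) e%:C e0').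
exists a, b; split => //.
  by move: ha; rewrite -ball_normE /= normE ltcR.
by move: hb; rewrite -ball_normE /= normE ltcR.
Qed.

Lemma denseE (D : set H) : dense D <-> forall x, clo D x.
Proof.
split=> [dD x e e0|h O [x Ox] oO].
  have e0' : 0 < e%:C by rewrite ltcR.
  have ob : open (ball x e%:C) by exact: ball_open.
  have nb : ball x e%:C !=set0 by exists x; exact: ballxx.
  have [y [hy Dy]] := dD _ nb ob.
  by exists y => //; move: hy; rewrite -ball_normE /= normE ltcR.
have /nbhs_ballP[e /= e0 hB] : nbhs x O by exact: open_nbhs_nbhs.
have eE : e = (complex.Re e)%:C by rewrite RRe_real// gtr0_real.
have e0' : 0 < complex.Re e by rewrite -ltcR -eE.
have [y Dy hy] := h x _ e0'; exists y; split => //; apply: hB.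
by rewrite -ball_normE /= normE eE ltcR.
Qed.

Definition unit_pair (u u' : H -> H) : Prop :=
  [/\ adj u u', forall x, u' (u x) = x & forall x, u (u' x) = x].

Lemma unitary_gr u u' : lin u -> unit_pair u u' -> unitary_op dot (gr u).
Proof.
move=> lu [a h1 h2]; have lu' := lin_adj lu a.
have bu : bdd u.
  by exists 1 => // x; rewrite mul1r rn_le2 a h1.
split; first exact: bounded_gr.
  rewrite (op_adjE lu' a) op_mulE op1E; congr gr.
  by apply/funext => x /=; rewrite h1.
rewrite (op_adjE lu' a) op_mulE op1E; congr gr.
by apply/funext => x /=; rewrite h2.
Qed.

Lemma unitary_pair u : lin u -> bdd u -> unitary_op dot (gr u) ->
  exists2 u', lin u' & unit_pair u u'.
Proof.
move=> lu bu [_]; have [u' lu' [bu' a]] := adjoint_exists lu bu.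
rewrite (op_adjE lu' a) !op_mulE op1E => /gr_inj h1 /gr_inj h2.
by exists u' => //; split => // x; [move: h1|move: h2] => /(congr1 (@^~ x)).
Qed.

(** * The algebra and its commutant *)

Section Algebra.
Context (M : set (oper H)).
Hypothesis hM : von_neumann_algebra dot M.

(* Members of [M] and of its commutant, as functions rather than graphs. *)
Definition Ma f := M (gr f).
Definition Mc g := commutant M (gr g).

Lemma M_gr T : M T -> exists2 f, Ma f & T = gr f.
Proof.
move=> MT; have [h _ _] := hM; have [f [_ _ e]] := bounded_opE (h T MT).
by exists f; rewrite /Ma -?e.
Qed.

Lemma bounded_op_gr f : bounded_op (gr f) -> lin f /\ bdd f.
Proof. by move=> /bounded_opE[g [lg bg /gr_inj ->]]. Qed.

Lemma Ma_lin f : Ma f -> lin f.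
Proof. by move=> Mf; have [h _ _] := hM; have [] := bounded_op_gr (h _ Mf). Qed.

Lemma Ma_bdd f : Ma f -> bdd f.
Proof. by move=> Mf; have [h _ _] := hM; have [] := bounded_op_gr (h _ Mf). Qed.

Lemma Mc_lin f : Mc f -> lin f.
Proof. by move=> [/bounded_op_gr[]]. Qed.

Lemma Mc_bdd f : Mc f -> bdd f.
Proof. by move=> [/bounded_op_gr[]]. Qed.

Lemma Ma_comm f g x : Ma f -> Mc g -> f (g x) = g (f x).
Proof.
move=> Mf [_ /(_ _ Mf)]; rewrite !op_mulE => /gr_inj/(congr1 (@^~ x)).
by move=> /= ->.
Qed.

Lemma Ma_intro f : lin f -> bdd f ->
  (forall g, Mc g -> forall x, f (g x) = g (f x)) -> Ma f.
Proof.
move=> lf bf h; have [_ _ e] := hM; rewrite /Ma -{}e; split; first exact: bounded_gr.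
move=> S MS; have [g [lg bg e]] := bounded_opE MS.1; rewrite e !op_mulE; congr gr.
by apply/funext => x /=; rewrite h// /Mc -e.
Qed.

Lemma Mc_intro f : lin f -> bdd f ->
  (forall g, Ma g -> forall x, f (g x) = g (f x)) -> Mc f.
Proof.
move=> lf bf h; split; first exact: bounded_gr.
move=> S /M_gr[g Mg ->]; rewrite !op_mulE; congr gr.
by apply/funext => x /=; rewrite h.
Qed.

Lemma Ma_adj f : Ma f -> exists2 f', Ma f' & adj f f'.
Proof.
move=> Mf; have [_ h _] := hM; have [g Mg e] := M_gr (h _ Mf).
by exists g => //; exact: op_adj_gr.
Qed.

Lemma Mc_adj f : Mc f -> exists2 f', Mc f' & adj f f'.
Proof.
move=> Mf; have [f' lf' [bf' a]] := adjoint_exists (Mc_lin Mf) (Mc_bdd Mf).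
exists f' => //; apply: Mc_intro => // g Mg x.
have [g' Mg' ag] := Ma_adj Mg.
by apply: ip_ext => w; rewrite (adjC a) ag ag (adjC a) (Ma_comm _ Mg' Mf).
Qed.

Lemma Ma_id : Ma idfun.
Proof. by apply: Ma_intro => //; exact: bdd_id. Qed.

Lemma Ma_cst0 : Ma (fun=> 0).
Proof.
apply: Ma_intro => [||g Mg x]; [exact: lin_cst0|exact: bdd_cst0|].
by rewrite (lin0 (Mc_lin Mg)).
Qed.

Lemma Ma_comp f g : Ma f -> Ma g -> Ma (f \o g).
Proof.
move=> Mf Mg; apply: Ma_intro => [||h Mh x /=].
- by apply: lin_comp; exact: Ma_lin.
- by apply: bdd_comp; exact: Ma_bdd.
- by rewrite (Ma_comm _ Mg Mh) (Ma_comm _ Mf Mh).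
Qed.

Lemma Ma_add f g : Ma f -> Ma g -> Ma (fun x => f x + g x).
Proof.
move=> Mf Mg; apply: Ma_intro => [||h Mh x /=].
- by apply: lin_add; exact: Ma_lin.
- by apply: bdd_add; exact: Ma_bdd.
- by rewrite (Ma_comm _ Mg Mh) (Ma_comm _ Mf Mh) (linD _ _ (Mc_lin Mh)).
Qed.

Lemma Ma_scale a f : Ma f -> Ma (fun x => a *: f x).
Proof.
move=> Mf; apply: Ma_intro => [||h Mh x /=].
- by apply: lin_scale; exact: Ma_lin.
- by apply: bdd_scale; exact: Ma_bdd.
- by rewrite (Ma_comm _ Mf Mh) (linZ _ _ (Mc_lin Mh)).
Qed.

Lemma Ma_sub f g : Ma f -> Ma g -> Ma (fun x => f x - g x).
Proof.
move=> Mf Mg; apply: Ma_intro => [||h Mh x /=].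
- by apply: lin_sub; exact: Ma_lin.
- by apply: bdd_sub; exact: Ma_bdd.
- by rewrite (Ma_comm _ Mg Mh) (Ma_comm _ Mf Mh) (linB _ _ (Mc_lin Mh)).
Qed.

(* [s + i (1 - s^2)^(1/2)] and [s - i (1 - s^2)^(1/2)] are unitaries with sum [2 s]. *)
Lemma comm_adj_contraction f s : lin f -> Mc s -> adj s s ->
  (forall x, rn (s x) <= rn x) ->
  (forall u u', Mc u -> unit_pair u u' -> forall x, f (u x) = u (f x)) ->
  forall x, f (s x) = s (f x).
Proof.
move=> lf Ms a cs h.
have ls := Mc_lin Ms; have bs := Mc_bdd Ms.
have [T [lT bT aT T2 [_ cT]]] : exists T,
  [/\ lin T, bdd T, adj T T, forall x, T (T x) = x - s (s x) &
   (forall x, 0 <= ip (T x) x) /\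
   forall f, lin f -> bdd f -> (forall x, f (s (s x)) = s (s (f x))) ->
     forall x, f (T x) = T (f x)].
  apply: (@sqrt_exists (s \o s)); first exact: lin_comp.
    by move=> x /=; apply: le_trans (cs _) (cs _).
  exact: adj_comp.
have MT : Mc T.
  apply: Mc_intro => // g Mg x; rewrite -cT//; [exact: Ma_lin|exact: Ma_bdd|].
  by move=> y; rewrite !(Ma_comm _ Mg Ms).
have sT x : s (T x) = T (s x) by apply: cT.
pose u (b : R[i]) x := s x + (b * 'i%C) *: T x.
have lu b : lin (u b) by apply: lin_add => //; exact: lin_scale.
have Mu b : Mc (u b).
  apply: Mc_intro => [//||g Mg x]; first by apply: bdd_add => //; exact: bdd_scale.
  rewrite /u (linD _ _ (Ma_lin Mg)) (linZ _ _ (Ma_lin Mg)).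
  by rewrite (Ma_comm _ Mg Ms) (Ma_comm _ Mg MT).
have ub (b : R[i]) : b ^+ 2 = 1 -> forall x, u (- b) (u b x) = x.
  move=> b2 x; rewrite /u (linD _ _ ls) (linD _ _ lT) (linZ _ _ ls) (linZ _ _ lT) sT T2.
  have i2 : 'i%C * 'i%C = -1 :> R[i] by rewrite -expr2 sqr_i.
  apply: dot_ext => w; rewrite !(dotDl, dotZl, dotNl).
  transitivity (dot (s (s x)) w
    - (b ^+ 2 * ('i%C * 'i%C)) * (dot x w - dot (s (s x)) w)); first by ring.
  by rewrite b2 i2; ring.
have au (b : R[i]) : b = 1 \/ b = -1 -> adj (u b) (u (- b)).
  move=> hb x y; rewrite /u ipDl ipDr a; congr (_ + _).
  rewrite ip_scale aT; congr ip; rewrite (linZ _ _ lT); congr (_ *: _).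
  have bR : b^*%C = b by case: hb => ->; rewrite ?rmorphN rmorph1.
  have -> : (b * 'i%C)^*%C = b^*%C * ('i^*)%C by exact: rmorphM.
  by rewrite bR conjc_i mulrN mulNr.
have pu (b : R[i]) : b = 1 \/ b = -1 -> unit_pair (u b) (u (- b)).
  move=> hb; have b2 : b ^+ 2 = 1 by case: hb => ->; rewrite ?sqrrN expr1n.
  split; [exact: au|exact: ub|move=> x].
  by rewrite -{1}[b]opprK ub// sqrrN.
move=> x; have e1 := h _ _ (Mu 1) (pu 1 (or_introl erefl)) x.
have e2 := h _ _ (Mu (-1)) (pu (-1) (or_intror erefl)) x.
move: e1 e2; rewrite /u !(linD _ _ lf) !(linZ _ _ lf) => e1 e2.
apply: ip_ext => w; move/(congr1 (ip^~ w)): e1; move/(congr1 (ip^~ w)): e2.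
by rewrite mulN1r mul1r !scaleNr !ipE; lra.
Qed.

Lemma grP f x y : gr f (x, y) -> y = f x.
Proof. by []. Qed.

Lemma adj_scale b f f' : lin f' -> adj f f' ->
  adj (fun x => b *: f x) (fun x => b^*%C *: f' x).
Proof. by move=> lf a x y; rewrite ip_scale a (linZ _ _ lf). Qed.

Lemma Mc_add f g : Mc f -> Mc g -> Mc (fun x => f x + g x).
Proof.
move=> Mf Mg; apply: Mc_intro => [||h Mh x /=].
- by apply: lin_add; exact: Mc_lin.
- by apply: bdd_add; exact: Mc_bdd.
- by rewrite (linD _ _ (Ma_lin Mh)) (Ma_comm _ Mh Mf) (Ma_comm _ Mh Mg).
Qed.

Lemma Mc_scale a f : Mc f -> Mc (fun x => a *: f x).
Proof.
move=> Mf; apply: Mc_intro => [||h Mh x /=].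
- by apply: lin_scale; exact: Mc_lin.
- by apply: bdd_scale; exact: Mc_bdd.
- by rewrite (linZ _ _ (Ma_lin Mh)) (Ma_comm _ Mh Mf).
Qed.

Lemma Mc_sub f g : Mc f -> Mc g -> Mc (fun x => f x - g x).
Proof.
move=> Mf Mg; apply: Mc_intro => [||h Mh x /=].
- by apply: lin_sub; exact: Mc_lin.
- by apply: bdd_sub; exact: Mc_bdd.
- by rewrite (linB _ _ (Ma_lin Mh)) (Ma_comm _ Mh Mf) (Ma_comm _ Mh Mg).
Qed.

(** Affiliation tests commutation with unitaries only. A self-adjoint element of the commutant
    becomes a contraction after rescaling and is covered by [comm_adj_contraction]; any [g] is
    recovered from the self-adjoint elements g + g' and i (g - g'). *)
Lemma comm_unitaries f : lin f -> bdd f ->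
  (forall u u', Mc u -> unit_pair u u' -> forall x, f (u x) = u (f x)) -> Ma f.
Proof.
move=> lf bf h; apply: Ma_intro => //.
have hs s : Mc s -> adj s s -> forall x, f (s x) = s (f x).
  move=> Ms a x; have [c c0 hc] := Mc_bdd Ms.
  have := @comm_adj_contraction f (fun x => (c^-1)%:C *: s x) lf (Mc_scale _ Ms).
  move=> /(_ (adj_real _ a)) H1; have {H1} := H1 _ h x.
  have cs z : rn ((c^-1)%:C *: s z) <= rn z.
    rewrite rnZC ger0_norm ?invr_ge0 ?(ltW c0)//.
    by rewrite mulrC ler_pdivrMr// mulrC.
  move=> /(_ cs); rewrite (linZ _ _ lf) => /scalerI; apply.
  by rewrite eq_complex /= eqxx andbT invr_eq0 gt_eqF.
move=> g Mg x; have [g' Mg' a] := Mc_adj Mg.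
have e1 : f (g x + g' x) = g (f x) + g' (f x).
  apply: (hs _ (Mc_add Mg Mg')) => u v.
  by rewrite (adj_add a (adjC a)) addrC.
have e2 : f ('i%C *: (g x - g' x)) = 'i%C *: (g (f x) - g' (f x)).
  apply: (hs _ (Mc_scale 'i%C (Mc_sub Mg Mg'))).
  have a2 := adj_scale 'i%C (lin_sub (Mc_lin Mg') (Mc_lin Mg)) (adj_sub a (adjC a)).
  move=> u v; rewrite a2; congr ip.
  by rewrite conjc_i scaleNr -scalerN opprB.
apply: dot_ext => w; move/(congr1 (dot^~ w)): e1.
move: e2; rewrite (linZ _ _ lf) => /(scalerI neq0Ci_complex).
rewrite !(linD _ _ lf) (linN _ lf) => /(congr1 (dot^~ w)).
rewrite !(dotDl, dotNl) => h1 h2.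
apply: (@mulfI _ 2); first by rewrite pnatr_eq0.
transitivity (dot (f (g x)) w + dot (f (g' x)) w +
  (dot (f (g x)) w - dot (f (g' x)) w)); first by ring.
by rewrite h1 h2; ring.
Qed.

(** * Positive elements, affiliated operators and bounded forms *)

Definition posM f := [/\ Ma f, adj f f & forall x, 0 <= ip (f x) x].

Lemma gr_nonneg f : lin f -> adj f f -> (forall x, 0 <= ip (f x) x) ->
  nonneg_op dot (gr f).
Proof.
move=> lf a f0; split; first exact: op_adjE.
move=> x y; rewrite /gr /= => ->.
by apply: dot_ge0 => //; exact: dot_adj.
Qed.

Lemma nonneg_ip T x y : nonneg_op dot T -> T (x, y) -> 0 <= ip y x.
Proof. by move=> [_ h] /h; rewrite lecE => /andP[]. Qed.

Lemma nonneg_sym T x y u v : nonneg_op dot T -> T (x, y) -> T (u, v) ->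
  ip y u = ip x v.
Proof. by move=> [e _] Txy; rewrite -{1}e => /(_ x y Txy) h; rewrite /ip h. Qed.

Lemma gr_nonneg_posM f : Ma f -> nonneg_op dot (gr f) -> posM f.
Proof.
move=> Mf h; split => // [x y|x]; first exact: (nonneg_sym h).
by apply: (nonneg_ip h).
Qed.

Lemma gr_closed f : lin f -> bdd f -> closed (gr f : set (H * H)).
Proof.
move=> lf bf; apply/closedE => x y h; rewrite /gr /=; apply/eqP.
rewrite -subr_eq0; apply/eqP/rn_small => e e0.
have [c c0 hc] := bf; have c1 : 0 < 1 + c by lra.
have [a [b [/grP-> ha hb]]] := h _ (divr_gt0 e0 c1).
have -> : y - f x = (y - f a) - f (x - a) by rewrite (linB _ _ lf); vec.
apply: le_trans (rnB _ _) _; have := hc (x - a); move: ha hb.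
by rewrite !ltr_pdivlMr//; have := rn_ge0 (x - a); nra.
Qed.

Lemma Ma_affiliated f : Ma f -> affiliated dot M (gr f).
Proof.
move=> Mf; have lf := Ma_lin Mf; have bf := Ma_bdd Mf; split.
  split; [exact: linear_gr|exact: gr_closed|apply/denseE => x].
  by apply: sub_clo; exists (f x).
move=> U MU uU; have [u [lu bu e]] := bounded_opE MU.1; rewrite e in MU uU *.
have [u' lu' [_ h1 h2]] := unitary_pair lu bu uU.
rewrite op_mulE; rewrite /gr /op_mul /op_inv; apply/seteqP; split=> -[x y] /=.
  by move=> [z -> ->]; rewrite (Ma_comm _ Mf MU).
by move=> ->; exists (u' x); rewrite ?h2// -(Ma_comm _ Mf MU) h2.
Qed.

Lemma affiliated_Ma f : lin f -> bdd f -> affiliated dot M (gr f) -> Ma f.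
Proof.
move=> lf bf [_ h]; apply: comm_unitaries => // u u' Mu pu x.
have := h _ Mu (unitary_gr (Mc_lin Mu) pu).
rewrite op_mulE; rewrite /gr /op_mul /op_inv => /seteqP[h1 _].
have := h1 (u x, u (f x)); rewrite /= => -> //.
by exists x.
Qed.

(* The bound on the form bounds [T] on its domain, which is then closed and dense. *)
Lemma bounded_of_form (T : oper H) (c : R) : closed_densely_defined T ->
  nonneg_op dot T -> 0 < c ->
  (forall x y, T (x, y) -> ip y x <= c * ip x x) ->
  exists f, [/\ lin f, bdd f & T = gr f].
Proof.
move=> [[Tf T0 TL] /closedE cT /denseE dT] nT c0 hc.
have bT x y : T (x, y) -> rn y <= c * rn x.
  move=> Txy.
  (* Polarization: compare the upper bound of the form at x + u with its positivity at x - u, and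
     use |x + u|^2 <= 2 (|x|^2 + |u|^2). *)
  have hd u v : T (u, v) -> 2 * ip y u <= c * (ip x x + ip u u).
    move=> Tuv; have Tp : T (x + u, y + v).
      by have := TL 1 _ _ _ _ Txy Tuv; rewrite !scale1r.
    have Tm : T (x - u, y - v).
      by have := TL (-1) _ _ _ _ Tuv Txy; rewrite !scaleN1r addrC [- v + _]addrC.
    have := hc _ _ Tp; have := nonneg_ip nT Tm.
    have := ip_ge0 (x - u); have := nonneg_sym nT Txy Tuv.
    rewrite !ipE (ipC u x) (ipC v x) (ipC v u) => e; nra.
  have hu u : 2 * ip y u <= c * (ip x x + ip u u).
    apply/ler_addgt0Pr => e e0.
    (* By density [u] is replaced by some [a] in the domain; [k] dominates the coefficients of the
       error terms, which are linear in |u - a| once |u - a| <= 1. *)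
    pose k := 2 * rn y + c * (2 * rn u + 1) + 1.
    have k1 : 1 <= k.
      by rewrite /k; have := rn_ge0 y; have := rn_ge0 u; nra.
    have k0 : 0 < k by lra.
    have [|a [b Tab] ha] := dT u (Num.min 1 (e / k)).
      by rewrite lt_min ltr01 divr_gt0.
    move: ha; rewrite lt_min ltr_pdivlMr// => /andP[ha1 ha2].
    have := hd _ _ Tab; have -> : a = u - (u - a) by rewrite subKr.
    move: (u - a) ha1 ha2 => d ha1 ha2.
    have := ip_abs y d; have := ip_abs u d; rewrite !ler_norml => /andP[h1 h2] /andP[h3 h4].
    rewrite !ipE (ipC d u) -(rn2 d).
    have := rn_ge0 d; have := rn_ge0 u; have := rn_ge0 y; move: ha2; rewrite /k.
    set D := rn d in ha1 h1 h2 h3 h4 *; move=> ha2 y0 u0 d0.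
    have dd : D ^+ 2 <= D by rewrite expr2; nra.
    have : c * D ^+ 2 <= c * D by rewrite ler_pM2l.
    have : c * (- ip u d) <= c * (rn u * D) by rewrite ler_pM2l//; lra.
    nra.
  rewrite -ler_sqr ?nnegrE ?rn_ge0 ?mulr_ge0 ?(ltW c0)// ?rn_ge0// exprMn !rn2.
  (* This choice of [u] turns the estimate into |y|^2 <= c^2 |x|^2. *)
  have := hu ((c^-1)%:C *: y); rewrite !ipE.
  have e : c * (c^-1 * (c^-1 * ip y y)) = c^-1 * ip y y by rewrite mulVKf// gt_eqF.
  rewrite mulrDr e => h.
  have : c^-1 * ip y y <= c * ip x x by lra.
  by rewrite ler_pdivrMl// mulrA -expr2.
have /choice[f hf] x : exists y, T (x, y).
  have /choice[a ha] n : exists a, dom T a /\ rn (x - a) < invS n.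
    by have [a Ta hx] := dT x _ (invS_gt0 n); exists a.
  have /choice[b hb] n : exists b, T (a n, b) by have [] := ha n.
  have [|y hy] := @tends_complete b.
    move=> e e0; have e2 : 0 < e / 2 / c by rewrite !divr_gt0.
    have [N hN] := invS_small e2; exists N => m n hm hn.
    have Td : T (a m - a n, b m - b n).
      by have := TL (-1) _ _ _ _ (hb n) (hb m); rewrite !scaleN1r addrC [- b n + _]addrC.
    apply: le_lt_trans (bT _ _ Td) _.
    have -> : a m - a n = (x - a n) - (x - a m) by vec.
    have := rnB (x - a n) (x - a m); have := (ha n).2; have := (ha m).2.
    have := hN m hm; have := hN n hn; rewrite !ltr_pdivlMr//.
    by nra.
  exists y; apply: cT => e e0.
  have [N1 h1] := invS_small e0; have [N2 h2] := hy _ e0.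
  exists (a (maxn N1 N2)), (b (maxn N1 N2)); split; first exact: hb.
    by apply: lt_trans (ha _).2 _; apply: h1; exact: leq_maxl.
  by rewrite rn_sub; apply: h2; exact: leq_maxr.
exists f; split.
- move=> a x y; apply: (Tf (a *: x + y)); first exact: hf.
  by apply: TL; exact: hf.
- by exists c => // x; exact: bT (hf x).
apply/seteqP; split=> -[x y]; rewrite /gr /=; first by move=> h; exact: Tf h (hf x).
by move=> ->; exact: hf.
Qed.

(** * Projections and partial isometries *)

Definition proj p := [/\ Ma p, forall x, p (p x) = p x & adj p p].

(** The commutant contains the adjoint of each of its members [g], so both preserve [K] and [p]
    commutes with [g]. Hence [p] lies in the bicommutant, which is [M]. *)
Lemma proj_exists K : subspace K ->
  (forall g, Mc g -> forall k, K k -> K (g k)) -> exists p,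
  [/\ proj p, (forall x, clo K (p x)), (forall k, K k -> p k = k) &
   forall f f', lin f -> bdd f -> adj f f' ->
     (forall k, K k -> K (f k)) -> (forall k, K k -> K (f' k)) ->
     forall x, p (f x) = f (p x)].
Proof.
move=> sK hK; have [p [lp bp ap cp [pK hp]]] := orth_projection sK.
have pc k : clo K k -> p k = k.
  by apply: (@clo_eq K p idfun) => //; exact: bdd_id.
exists p; split => //; split => // [|x]; last exact: pc.
apply: Ma_intro => // g Mg x; have [g' Mg' a] := Mc_adj Mg.
by apply: (hp g g' (Mc_lin Mg) (Mc_bdd Mg) a); exact: hK.
Qed.

Lemma polarization f g : lin f -> lin g -> (forall x, rn (f x) = rn (g x)) ->
  forall x y, ip (f x) (f y) = ip (g x) (g y).
Proof.
move=> lf lg h x y.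
have e z : ip (f z) (f z) = ip (g z) (g z) by rewrite -!rn2 h.
have := e (x + y); rewrite (linD _ _ lf) (linD _ _ lg) !ipE !e.
by rewrite (ipC (f y)) (ipC (g y)); lra.
Qed.

(* The graphs of the restrictions of partial isometries of [M] to subspaces of
   their initial spaces; ordered by inclusion they suit Zorn's lemma. *)
Definition isograph (G : set (H * H)) : Prop :=
  [/\ subspace (G : set (H * H)%type),
      forall g, Mc g -> forall x y, G (x, y) -> G (g x, g y) &
      forall x y, G (x, y) -> rn x = rn y].

Definition pisom W W' :=
  [/\ Ma W, Ma W', adj W W' & forall x, W (W' (W x)) = W x].

Lemma pisom_sym W W' : pisom W W' -> pisom W' W.
Proof.
move=> [MW MW' a h]; split => //; first exact: adjC.
by move=> x; apply: ip_ext => w; rewrite !(adjC a, a) h.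
Qed.

Lemma pisom_proj W W' : pisom W W' -> proj (W' \o W).
Proof.
move=> [MW MW' a h]; split=> [|x /=|]; first exact: Ma_comp.
  by rewrite h.
by apply: adj_comp => //; exact: adjC.
Qed.

(** The closure of [G] is the graph of an isometry on the closure of the domain, and [W] is this
    isometry after the projection [p] onto that closure. Both commute with the commutant, so [W] is
    in [M]. *)
Lemma isograph_pisom G : isograph G -> exists W W',
  [/\ pisom W W', forall x y, G (x, y) -> W x = y /\ W' y = x,
      forall x, clo (dom G) (W' x) & forall x, clo (ran G) (W x)].
Proof.
move=> [sG cG iG].
have linG a x y x' y' : G (x, y) -> G (x', y') -> G (a *: x + x', a *: y + y').
  by move=> h1 h2; exact: (sG.2 a (x, y) (x', y')).
pose K := dom G; have sK : subspace K.
  split; first by exists 0; exact: sG.1.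
  by move=> a x x' [y hy] [y' hy']; exists (a *: y + y'); exact: linG.
have [|p [[Mp pp ap] cp pK _]] := proj_exists sK.
  by move=> g Mg x [y hy]; exists (g y); exact: cG.
have lp := Ma_lin Mp; have bp := Ma_bdd Mp.
pose C x y := forall e : R, 0 < e ->
  exists a b, [/\ G (a, b), rn (x - a) < e & rn (y - b) < e].
have Clin a x y x' y' : C x y -> C x' y' -> C (a *: x + x') (a *: y + y').
  move=> h h' e e0; pose c := 1 + complex.Re `|a|.
  have c0 : 0 < c by rewrite /c; have := nc_ge0 a; lra.
  have e2 : 0 < e / 2 by rewrite divr_gt0.
  have [u [v [Guv hu hv]]] := h _ (divr_gt0 e2 c0).
  have [u' [v' [Guv' hu' hv']]] := h' _ e2.
  have est w w' z z' : rn (w - z) < e / 2 / c -> rn (w' - z') < e / 2 ->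
      rn (a *: w + w' - (a *: z + z')) < e.
    have -> : a *: w + w' - (a *: z + z') = a *: (w - z) + (w' - z').
      by rewrite scalerBr; vec.
    move=> h1 h2; apply: le_lt_trans (rnD _ _) _; rewrite rnZ.
    move: h1; rewrite ltr_pdivlMr// /c.
    by have := nc_ge0 a; have := rn_ge0 (w - z); nra.
  exists (a *: u + u'), (a *: v + v'); split; [exact: linG|exact: est|exact: est].
have Cg g x y : Mc g -> C x y -> C (g x) (g y).
  move=> Mg h e e0; have [c c0 hc] := Mc_bdd Mg.
  have [u [v [Guv hu hv]]] := h _ (divr_gt0 e0 c0).
  exists (g u), (g v); split; first exact: cG.
    rewrite -(linB _ _ (Mc_lin Mg)); apply: le_lt_trans (hc _) _.
    by rewrite mulrC -ltr_pdivlMr.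
  rewrite -(linB _ _ (Mc_lin Mg)); apply: le_lt_trans (hc _) _.
  by rewrite mulrC -ltr_pdivlMr.
have Ciso x y : C x y -> rn x = rn y.
  move=> h; have est (u v : H) : (forall e : R, 0 < e -> exists a b,
      [/\ rn a = rn b, rn (u - a) < e & rn (v - b) < e]) -> rn u <= rn v.
    move=> huv; apply/ler_addgt0Pr => e e0.
    have [a [b [ab ha hb]]] := huv _ (divr_gt0 e0 (ltr0n R 2)).
    have h1 : rn b <= rn v + rn (v - b) by rewrite -{1}(subKr v b) rnB.
    have h2 : rn u <= rn (u - a) + rn a by rewrite -{1}(subrK a u) rnD.
    by lra.
  apply/eqP; rewrite eq_le !est//.
    by move=> e /h[a [b [/iG ab ha hb]]]; exists b, a; split.
  by move=> e /h[a [b [/iG ab ha hb]]]; exists a, b; split.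
have C0 y : C 0 y -> y = 0 by move=> /Ciso e; apply: rn_eq0; rewrite -e rn0.
have Cuniq x y z : C x y -> C x z -> y = z.
  move=> h1 h2; have := Clin (-1) _ _ _ _ h2 h1.
  rewrite !scaleN1r addNr => /C0 e; apply/eqP; rewrite -subr_eq0 addrC e; exact/eqP.
have Cex x : clo K x -> exists y, C x y.
  move=> hx.
  have /choice[ab hab] n : exists ab, G ab /\ rn (x - ab.1) < invS n.
    by have [a [b Gab] ha] := hx _ (invS_gt0 n); exists (a, b).
  have [|y hy] := @tends_complete (fun n => (ab n).2).
    move=> e e0; have [N hN] := invS_small (divr_gt0 e0 (ltr0n R 2)).
    exists N => m n hm hn.
    have : G ((ab m).1 - (ab n).1, (ab m).2 - (ab n).2).
      have := linG (-1) _ _ _ _ (_ : G ((ab n).1, (ab n).2)) (_ : G ((ab m).1, (ab m).2)).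
      rewrite !scaleN1r addrC [- (ab n).2 + _]addrC -!surjective_pairing; apply.
        exact: (hab n).1.
      exact: (hab m).1.
    move=> /iG <-.
    have -> : (ab m).1 - (ab n).1 = (x - (ab n).1) - (x - (ab m).1) by vec.
    apply: le_lt_trans (rnB _ _) _; have := (hab n).2; have := (hab m).2.
    by have := hN m hm; have := hN n hn; lra.
  exists y => e e0; have [N1 h1] := invS_small e0; have [N2 h2] := hy _ e0.
  pose n := maxn N1 N2; exists (ab n).1, (ab n).2; split.
  - by rewrite -surjective_pairing; exact: (hab n).1.
  - by apply: lt_trans (hab _).2 _; apply: h1; exact: leq_maxl.
  - by rewrite rn_sub; apply: h2; exact: leq_maxr.
have /choice[W hW] x : exists y, C (p x) y by apply: Cex; exact: cp.
have lW : lin W.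
  by move=> a x y; apply: (Cuniq _ _ _ (hW _)); rewrite lp; exact: Clin.
have iW x : rn (W x) = rn (p x) by rewrite -(Ciso _ _ (hW x)).
have bW : bdd W by have [c c0 hc] := bp; exists c => // x; rewrite iW.
have MW : Ma W.
  apply: Ma_intro => // g Mg x; apply: (Cuniq _ _ _ (hW _)).
  by rewrite (Ma_comm _ Mp Mg); exact: Cg.
have [W' MW' aW] := Ma_adj MW.
(* Polarizing |W x| = |p x| gives W' W = p. *)
have W'W x : W' (W x) = p x.
  apply: ip_ext => w; rewrite (adjC aW) (polarization lW lp iW) ap.
  by rewrite pp ap.
have Wp x : W (p x) = W x.
  apply/eqP; rewrite -subr_eq0 -(linB _ _ lW); apply/eqP/rn_eq0.
  by rewrite iW (linB _ _ lp) pp subrr rn0.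
have GW x y : G (x, y) -> W x = y.
  move=> Gxy; apply: (Cuniq _ _ _ (hW _)); rewrite pK; last by exists y.
  by move=> e e0; exists x, y; split; rewrite ?subrr ?rn0.
exists W, W'; split.
- by split => // x; rewrite W'W Wp.
- move=> x y Gxy; split; first exact: GW.
  by rewrite -(GW _ _ Gxy) W'W pK//; exists y.
- move=> x; have -> : W' x = p (W' x); last exact: cp.
  by apply: ip_ext => w; rewrite ap !(adjC aW) Wp.
- by move=> x e /(hW x)[a [b [Gab _ hb]]]; exists b => //; exists a.
Qed.

(* [G] is the set of the [(|D| x, D x)] for a multiple [D] of [B]. *)
Lemma polar B : Ma B -> (exists x, B x <> 0) -> exists G,
  [/\ isograph G, exists x y, G (x, y) /\ x <> 0,
      forall x y, G (x, y) -> exists z, y = B z &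
      forall x y z, G (x, y) -> B z = 0 -> ip x z = 0].
Proof.
move=> MB [x0 Bx0]; have [c c0 hc] := Ma_bdd MB.
pose D x := (c^-1)%:C *: B x; have MD : Ma D by exact: Ma_scale.
have cD x : rn (D x) <= rn x.
  rewrite rnZC ger0_norm ?invr_ge0 ?(ltW c0)//.
  by rewrite mulrC ler_pdivrMr// mulrC.
have [D' MD' aD] := Ma_adj MD; have lD := Ma_lin MD.
have [T [lT bT aT T2 [_ cT]]] := abs_exists lD aD cD.
have MT : Ma T.
  apply: Ma_intro => // g Mg x; rewrite -cT//; [exact: Mc_lin|exact: Mc_bdd|].
  by move=> z; rewrite -(Ma_comm _ MD' Mg) -(Ma_comm _ MD Mg).
have iT x : rn (T x) = rn (D x).
  by apply/eqP; rewrite eq_le !rn_le2 aT T2 -aD lexx.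
pose G := [set q : H * H | exists x, q = (T x, D x)].
exists G; split.
- split=> [|g Mg _ _ [x [-> ->]]|_ _ [x [-> ->]]]; last exact: iT.
    split; first by exists 0; rewrite !lin0.
    by move=> a _ _ [x ->] [y ->]; exists (a *: x + y); rewrite lT lD.
  by exists (g x); rewrite (Ma_comm _ MT Mg) (Ma_comm _ MD Mg).
- exists (T x0), (D x0); split; first by exists x0.
  move=> e; apply: Bx0; have := iT x0; rewrite e rn0 => /esym/rn_eq0.
  move=> /eqP; rewrite /D scaler_eq0 => /orP[|/eqP//].
  by rewrite eq_complex /= eqxx andbT invr_eq0 gt_eqF.
- by move=> _ _ [x [_ ->]]; exists ((c^-1)%:C *: x); rewrite (linZ _ _ (Ma_lin MB)).
- move=> _ _ z [x [-> _]] Bz; rewrite aT.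
  suff -> : T z = 0 by rewrite ip0r.
  by apply: rn_eq0; rewrite iT /D Bz scaler0 rn0.
Qed.

Lemma isograph_sum G G' : isograph G -> isograph G' ->
  (forall x y x' y', G (x, y) -> G' (x', y') -> ip x x' = 0 /\ ip y y' = 0) ->
  isograph [set q | exists x y x' y',
    [/\ G (x, y), G' (x', y') & q = (x + x', y + y')]].
Proof.
move=> [sG cG iG] [sG' cG' iG'] o; split.
- split; first by exists 0, 0, 0, 0; split; [exact: sG.1|exact: sG'.1|rewrite !addr0].
  move=> a _ _ [x [y [x' [y' [h h' ->]]]]] [u [v [u' [v' [k k' ->]]]]].
  exists (a *: x + u), (a *: y + v), (a *: x' + u'), (a *: y' + v'); split.
  + exact: (sG.2 a (x, y) (u, v)).
  + exact: (sG'.2 a (x', y') (u', v')).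
  + by congr pair; rewrite /= scalerDr; vec.
- move=> g Mg _ _ [x [y [x' [y' [h h' [-> ->]]]]]].
  exists (g x), (g y), (g x'), (g y'); split; [exact: cG|exact: cG'|].
  by rewrite !(linD _ _ (Mc_lin Mg)).
- move=> _ _ [x [y [x' [y' [h h' [-> ->]]]]]].
  have [ox oy] := o _ _ _ _ h h'; have e := iG _ _ h; have e' := iG' _ _ h'.
  apply/eqP; rewrite eq_le !rn_le2 !ipE (ipC x') (ipC y') ox oy -!rn2 e e'.
  by rewrite lexx.
Qed.

(** Both conditions pass to the union of a chain: [Q] concerns two elements, which lie in a common
    member of the chain, and [L] can only become easier as the set grows. *)
Lemma zorn_subspace (V : lmodType R[i]) (Q : V -> V -> Prop)
    (L : set V -> V -> Prop)
    (good := fun G : set V => [/\ subspace G, forall s t, G s -> G t -> Q s t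
                                & forall s, G s -> L G s]) :
  (forall G G' s, G `<=` G' -> L G s -> L G' s) -> good [set 0] ->
  exists2 G, good G & forall G', G `<=` G' -> good G' -> G' `<=` G.
Proof.
move=> mono g0; pose P := [set G | G = set0 \/ good G].
have [F FP tF|A [PA maxA]] := @Zorn_bigcup V P.
  have [[G0 FG0 gG0]|h] := pselect (exists2 G, F G & good G); last first.
    left; apply/seteqP; split => // x [G FG Gx].
    by have [e|gG] := FP G FG; [rewrite e in Gx|case: h; exists G].
  right; have two s t : (\bigcup_(X in F) X) s -> (\bigcup_(X in F) X) t ->
      exists G, [/\ F G, good G, G s & G t].
    move=> [G FG Gs] [G' FG' Gt].
    have [le|le] := tF _ _ FG FG'.
      have [e|gG] := FP G' FG'; first by rewrite e in Gt.
      by exists G'; split => //; exact: le.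
    have [e|gG] := FP G FG; first by rewrite e in Gs.
    by exists G; split => //; exact: le.
  split.
  - split; first by exists G0 => //; case: gG0 => -[].
    move=> a s t hx hy; have [G [FG [[_ gG] _ _] Gx Gy]] := two _ _ hx hy.
    by exists G => //; exact: gG.
  - by move=> s t hs ht; have [G [FG [_ gG _] Gx Gy]] := two _ _ hs ht; exact: gG.
  - move=> s hs; have [G [FG [_ _ gG] Gx _]] := two _ _ hs hs.
    by apply: (mono G) => [x Gx'|]; [exists G|exact: gG].
have gA : good A.
  case: PA => // A0; exfalso; apply: (maxA [set 0]); last by right.
  by rewrite A0; split => // /(_ 0 erefl).
exists A => // G' AG' gG'; apply: contrapT => nle.
by apply: (maxA G'); [split|right].
Qed.

(** * Maximal partial isometries: comparison and halving of projections *)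

Lemma proj_adjoint_fix p f f' : adj f f' -> adj p p -> (forall x, p (f x) = f x) ->
  forall x, f' (p x) = f' x.
Proof. by move=> a ap h x; apply: ip_ext => w; rewrite !(adjC a) ap h. Qed.

Lemma clo_fix K p x : lin p -> bdd p -> (forall k, K k -> p k = k) ->
  clo K x -> p x = x.
Proof. by move=> lp bp h; apply: (@clo_eq K p idfun) => //; exact: bdd_id. Qed.

Lemma pisom_sym_fix W W' x : pisom W W' -> W' (W (W' x)) = W' x.
Proof. by move=> /pisom_sym[]. Qed.

Lemma zorn_isograph (Q : H * H -> H * H -> Prop) : Q (0, 0) (0, 0) ->
  exists G, [/\ isograph G, forall s t, G s -> G t -> Q s t &
    forall G', isograph G' -> (forall s t, G' s -> G' t -> Q s t) ->
      G `<=` G' -> G' `<=` G].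
Proof.
move=> Q0; pose L (G : set (H * H)%type) s :=
  (forall g, Mc g -> G (g s.1, g s.2)) /\ rn s.1 = rn s.2.
have iso G : isograph G <-> subspace (G : set (H * H)%type) /\ forall s, G s -> L G s.
  split=> [[sG cG iG]|[sG LG]].
    by split=> // -[x y] Gxy; split=> [g Mg|]; [exact: cG|exact: iG].
  split=> // [g Mg x y /LG[h _]|x y /LG[_ //]]; exact: (h g Mg).
have [||G [sG QG LG] maxG] := @zorn_subspace (H * H)%type Q L.
- by move=> G G' s le [h1 h2]; split=> // g Mg; apply: le; exact: h1.
- split.
  + by split=> // a x y -> ->; rewrite scaler0 addr0.
  + by move=> s t -> ->.
  + by move=> s ->; split=> //= g Mg; rewrite (lin0 (Mc_lin Mg)).
exists G; split => //; first by apply/iso.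
by move=> G' /iso[sG' LG'] QG' le; apply: maxG.
Qed.

(** The orthogonal sum of [G] and [G'] is an admissible graph containing [G], so it gains nothing. A
    piece that is both orthogonal to [G] and contained in it is trivial, which is the contradiction
    drawn from this lemma. *)
Lemma isograph_absorb (Q : H * H -> H * H -> Prop) G G' :
  isograph G -> isograph G' ->
  (forall G', isograph G' -> (forall s t, G' s -> G' t -> Q s t) ->
    G `<=` G' -> G' `<=` G) ->
  (forall x y x' y', G (x, y) -> G' (x', y') -> ip x x' = 0 /\ ip y y' = 0) ->
  (forall s t s' t' : (H * H)%type, G s -> G t -> G' s' -> G' t' ->
     Q (s.1 + s'.1, s.2 + s'.2) (t.1 + t'.1, t.2 + t'.2)) ->
  G' `<=` G.
Proof.
move=> iG iG' maxG ort hQ [x y] hxy.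
apply: (maxG _ (isograph_sum iG iG' ort)).
- move=> _ _ [a [b [a' [b' [h h' ->]]]]] [u [v [u' [v' [k k' ->]]]]].
  exact: (hQ (a, b) (u, v) (a', b') (u', v')).
- move=> [u v] h; exists u, v, 0, 0; split; rewrite ?addr0//.
  by case: iG' => -[].
- exists 0, 0, x, y; split; rewrite ?add0r//.
  by case: iG => -[].
Qed.

(** Were (e - W W') B (n - W' W) nonzero for some [B], its polar graph would be orthogonal on both
    sides to the maximal graph behind [W] and could be added to it. The vanishing for all [B] at
    once is what allows a central projection to separate the two remainders. *)
Lemma comparison n e : proj n -> proj e -> exists W W',
  [/\ pisom W W', forall x, n (W' x) = W' x, forall x, e (W x) = W x &
      forall B x, Ma B -> let b := B (n x - W' (W x)) in e b = W (W' b)].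
Proof.
move=> [Mn nn an] [Me ee ae].
have [|G [iG QG maxG]] :=
  @zorn_isograph (fun s _ => n s.1 = s.1 /\ e s.2 = s.2).
  by rewrite /= (lin0 (Ma_lin Mn)) (lin0 (Ma_lin Me)).
have [W [W' [pW GW cW' cW]]] := isograph_pisom iG.
have [MW MW' aW WWW] := pW; have W'WW' x := pisom_sym_fix x pW.
have nW' x : n (W' x) = W' x.
  apply: (clo_fix (Ma_lin Mn) (Ma_bdd Mn) _ (cW' x)) => k [y Gky].
  by have [] := QG _ _ Gky Gky.
have eW x : e (W x) = W x.
  apply: (clo_fix (Ma_lin Me) (Ma_bdd Me) _ (cW x)) => k [y Gky].
  by have [] := QG _ _ Gky Gky.
exists W, W'; split => // B x MB b.
have Wn z : W (n z) = W z by exact: proj_adjoint_fix (adjC aW) an nW' z.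
have W'e z : W' (e z) = W' z by exact: proj_adjoint_fix aW ae eW z.
pose f z := e z - W (W' z); pose q z := n z - W' (W z).
have Mf : Ma f by apply: Ma_sub => //; exact: (Ma_comp MW MW').
have Mq : Ma q by apply: Ma_sub => //; exact: (Ma_comp MW' MW).
pose B1 := f \o (B \o q).
have MB1 : Ma B1 by apply: Ma_comp => //; exact: Ma_comp.
apply/eqP; rewrite -subr_eq0; apply/eqP; rewrite -[LHS]/(B1 x).
apply: contrapT => B1x.
have [G' [iG' [x1 [y1 [Gxy x1N0]]] G'B G'0]] := polar MB1 (ex_intro _ x B1x).
have lB := Ma_lin MB; have lf := Ma_lin Mf; have lq := Ma_lin Mq.
have G'n x' y' : G' (x', y') -> n x' = x' /\ W x' = 0.
  move=> h; split.
    apply: ip_ext => w; apply/eqP; rewrite an -subr_eq0 -opprB oppr_eq0.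
    rewrite -ipNr -ipDr (G'0 _ _ _ h)// /B1 /=.
    have -> : q (w - n w) = 0.
      rewrite /q (linB _ _ (Ma_lin Mn)) nn (linB _ _ (Ma_lin MW)) Wn !subrr.
      by rewrite (lin0 (Ma_lin MW')) subr0.
    by rewrite !lin0.
  apply: ip_ext => w; rewrite aW ip0l (G'0 _ _ _ h)// /B1 /=.
  have -> : q (W' w) = 0 by rewrite /q nW' W'WW' subrr.
  by rewrite !lin0.
have G'e x' y' : G' (x', y') -> e y' = y' /\ W' y' = 0.
  move=> /G'B[z ->]; rewrite /B1 /=; set t := B (q z); rewrite /f.
  by rewrite (linB _ _ (Ma_lin Me)) ee eW (linB _ _ (Ma_lin MW')) W'e W'WW' subrr.
have ort u v u' v' : G (u, v) -> G' (u', v') -> ip u u' = 0 /\ ip v v' = 0.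
  move=> /GW[<- <-] h; have [_ h1] := G'n _ _ h; have [_ h2] := G'e _ _ h.
  by rewrite (adjC aW) h1 ip0r aW h2 ip0r.
have G'G : G' `<=` G.
  apply: (isograph_absorb iG iG' maxG ort) => -[u v] _ [u' v'] _ h _ h' _ /=.
  have [/= h1 h2] := QG _ _ h h; have [h3 _] := G'n _ _ h'; have [h4 _] := G'e _ _ h'.
  by rewrite (linD _ _ (Ma_lin Mn)) (linD _ _ (Ma_lin Me)) h3 h4 h1 h2.
have [e1 e2] := GW _ _ (G'G _ Gxy); apply: x1N0; rewrite -e2 -e1.
by have [_ ->] := G'n _ _ Gxy; rewrite (lin0 (Ma_lin MW')).
Qed.

(** [W] comes from a maximal graph under [e] whose range is orthogonal to its domain. If a remainder
    [r] is left, a nonzero [B] in its corner with B^2 = 0 has its range inside its kernel, so the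
    polar graph of [B] has the same orthogonality and would enlarge the maximal one. *)
Lemma halving e : proj e ->
  (forall r, proj r -> (forall x, e (r x) = r x) -> (exists x, r x <> 0) ->
    exists B, [/\ Ma B, exists x, B x <> 0, forall x, r (B x) = B x,
      forall x, B (r x) = B x & forall x, B (B x) = 0]) ->
  exists W W', [/\ pisom W W', forall x, W (W x) = 0 &
    forall x, e x = W' (W x) + W (W' x)].
Proof.
move=> [Me ee ae] he; have le := Ma_lin Me.
have [|G [iG QG maxG]] := @zorn_isograph
  (fun s t => [/\ e s.1 = s.1, e s.2 = s.2 & ip s.2 t.1 = 0]).
  by rewrite /= (lin0 le) ip0l.
have [W [W' [pW GW cW' cW]]] := isograph_pisom iG.
have [MW MW' aW WWW] := pW; have W'WW' x := pisom_sym_fix x pW.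
have lW := Ma_lin MW; have lW' := Ma_lin MW'.
have eW' x : e (W' x) = W' x.
  apply: (clo_fix le (Ma_bdd Me) _ (cW' x)) => k [y Gky].
  by have [] := QG _ _ Gky Gky.
have eW x : e (W x) = W x.
  apply: (clo_fix le (Ma_bdd Me) _ (cW x)) => k [y Gky].
  by have [] := QG _ _ Gky Gky.
have We z : W (e z) = W z by exact: proj_adjoint_fix (adjC aW) ae eW' z.
have W'e z : W' (e z) = W' z by exact: proj_adjoint_fix aW ae eW z.
have WW x : W (W x) = 0.
  apply: ip_ext => w; rewrite ip0l aW; apply: clo_orth (cW x) => k [u Guk].
  rewrite ipC; apply: clo_orth (cW' w) => u' [k' Guk'].
  by rewrite ipC; have [] := QG _ _ Guk Guk'.
have W'W' x : W' (W' x) = 0.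
  by apply: ip_ext => w; rewrite !(adjC aW) WW ip0r ip0l.
exists W, W'; split => //; pose r x := e x - (W' (W x) + W (W' x)).
suff r0 x : r x = 0 by move=> x; apply/eqP; rewrite -subr_eq0; apply/eqP/r0.
apply: contrapT => rx.
have Mr : Ma r.
  by apply: Ma_sub => //; apply: Ma_add; [exact: (Ma_comp MW' MW)|exact: (Ma_comp MW MW')].
have lr := Ma_lin Mr.
have er y : e (r y) = r y by rewrite /r (linB _ _ le) (linD _ _ le) ee eW eW'.
have Wr y : W (r y) = 0.
  by rewrite /r (linB _ _ lW) (linD _ _ lW) We WWW WW addr0 subrr.
have W'r y : W' (r y) = 0.
  by rewrite /r (linB _ _ lW') (linD _ _ lW') W'e W'WW' W'W' add0r subrr.
have pr : proj r.
  split => // [y|].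
    rewrite -[LHS]/(e (r y) - (W' (W (r y)) + W (W' (r y)))) er Wr W'r.
    by rewrite (lin0 lW) (lin0 lW') addr0 subr0.
  apply: adj_sub => //; apply: adj_add; first exact: adj_comp (adjC aW) aW.
  exact: adj_comp aW (adjC aW).
have [_ _ ar] := pr.
have [B [MB Bx rB Br BB]] := he r pr er (ex_intro _ x rx).
have [G' [iG' [x1 [y1 [Gxy x1N0]]] G'B G'0]] := polar MB Bx.
have lB := Ma_lin MB.
have G'r x' y' : G' (x', y') -> r x' = x' /\ r y' = y'.
  move=> h; split; last by have [z ->] := G'B _ _ h; rewrite rB.
  apply: ip_ext => w; apply/eqP; rewrite ar -subr_eq0 -opprB oppr_eq0.
  rewrite -ipNr -ipDr (G'0 _ _ _ h)//.
  by rewrite (linB _ _ lB) Br subrr.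
have G'0W x' y' : G' (x', y') ->
    [/\ W x' = 0, W' x' = 0, W y' = 0 & W' y' = 0].
  by move=> /G'r[<- <-]; rewrite !Wr !W'r.
have ort u v u' v' : G (u, v) -> G' (u', v') -> ip u u' = 0 /\ ip v v' = 0.
  move=> /GW[<- <-] h; have [h1 h2 h3 h4] := G'0W _ _ h.
  by rewrite (adjC aW) h1 ip0r aW h4 ip0r.
have G'G : G' `<=` G.
  apply: (isograph_absorb iG iG' maxG ort) => -[u v] [a b] [u' v'] [a' b'] h k h' k' /=.
  have [/= h1 h2 h3] := QG _ _ h k; have [k1 k2] := G'r _ _ h'.
  split; first by rewrite (linD _ _ le) h1 -k1 er.
    by rewrite (linD _ _ le) h2 -k2 er.
  have [hv hu] := GW _ _ h; have [hb ha] := GW _ _ k.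
  have [_ _ m3 _] := G'0W _ _ h'; have [_ l2 _ _] := G'0W _ _ k'.
  have va' : ip v a' = 0 by rewrite -hv aW l2 ip0r.
  have v'a : ip v' a = 0 by rewrite -ha -aW m3 ip0l.
  have v'a' : ip v' a' = 0.
    by have [z ->] := G'B _ _ h'; rewrite ipC (G'0 _ _ _ k').
  by rewrite !ipE h3 va' v'a v'a' !addr0.
have [e1 e2] := GW _ _ (G'G _ Gxy); apply: x1N0; rewrite -e2 -e1.
by have [-> _ _ _] := G'0W _ _ Gxy; rewrite (lin0 lW').
Qed.

Lemma pythagoras x y : ip x y = 0 -> ip (x + y) (x + y) = ip x x + ip y y.
Proof. by move=> o; rewrite !ipE (ipC y x) o addr0 add0r. Qed.

(** * Algebras without nilpotents are abelian *)

(** Evaluating the form at x + u and x - u bounds 2 <C x, u> by d (|x|^2 + |u|^2); the choice u = C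
    x / d then bounds the norm. *)
Lemma numerical_radius C (d : R) : lin C -> adj C C -> 0 < d ->
  (forall x, `|ip (C x) x| <= d * ip x x) -> forall x, rn (C x) <= d * rn x.
Proof.
move=> lC aC d0 hC x; have h u : 2 * ip (C x) u <= d * (ip x x + ip u u).
  have := hC (x + u); have := hC (x - u).
  rewrite (linB _ _ lC) (linD _ _ lC) !ler_norml !ipE (ipC u x).
  by rewrite (aC u x) (ipC u); lra.
rewrite -ler_sqr ?nnegrE ?rn_ge0 ?mulr_ge0 ?(ltW d0) ?rn_ge0// exprMn !rn2.
have := h ((d^-1)%:C *: C x); rewrite !ipE.
have e : d * (d^-1 * (d^-1 * ip (C x) (C x))) = d^-1 * ip (C x) (C x).
  by rewrite mulVKf// gt_eqF.
rewrite mulrDr e => h1.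
have : d^-1 * ip (C x) (C x) <= d * ip x x by lra.
by rewrite ler_pdivrMl// mulrA -expr2.
Qed.

Lemma proj_contraction p x : proj p -> rn (p x) <= rn x.
Proof.
move=> [_ pp ap]; have : rn (p x) ^+ 2 <= rn x * rn (p x).
  by rewrite rn2 ap pp ip_le.
have := rn_ge0 (p x); rewrite le_eqVlt => /orP[/eqP <- _|p0].
  exact: rn_ge0.
by rewrite expr2 ler_pM2r.
Qed.

Lemma proj_sub p q : proj p -> proj q -> (forall x, q (p x) = p x) ->
  proj (fun x => q x - p x).
Proof.
move=> [Mp pp ap] [Mq qq aq] qp; have pq z : p (q z) = p z.
  exact: proj_adjoint_fix ap aq qp z.
split=> [|x|]; [exact: Ma_sub| |exact: adj_sub].
rewrite (linB _ _ (Ma_lin Mq)) (linB _ _ (Ma_lin Mp)) qq qp pq pp.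
by rewrite subrr subr0.
Qed.

(** With D = C / c and T = |D|, [p] projects onto the closed range of T + D, twice the positive part
    of D. From D (T + D) = T (T + D), the operators D and T agree on this range; on its orthogonal
    complement T + D = 0, so D = - T. *)
Lemma proj_split q C : proj q -> Ma C -> adj C C -> (forall x, q (C x) = C x) ->
  exists p, [/\ proj p, forall x, q (p x) = p x,
    forall x, p x = x -> 0 <= ip (C x) x & forall x, p x = 0 -> ip (C x) x <= 0].
Proof.
move=> [Mq qq aq] MC aC qC; have [c c0 hc] := Ma_bdd MC.
have Cq z : C (q z) = C z by exact: proj_adjoint_fix aC aq qC z.
pose D x := (c^-1)%:C *: C x; have MD : Ma D by exact: Ma_scale.
have aD : adj D D by exact: adj_real.
have cD x : rn (D x) <= rn x.
  rewrite rnZC ger0_norm ?invr_ge0 ?(ltW c0)//.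
  by rewrite mulrC ler_pdivrMr// mulrC.
have lD := Ma_lin MD; have lq := Ma_lin Mq.
have [T [lT bT aT T2 [T0 cT]]] := abs_exists lD aD cD.
have MT : Ma T.
  apply: Ma_intro => // g Mg x; rewrite -cT//; [exact: Mc_lin|exact: Mc_bdd|].
  by move=> z; rewrite -!(Ma_comm _ MD Mg).
have DT x : D (T x) = T (D x) by apply: cT => //; exact: Ma_bdd.
have qT x : q (T x) = T x.
  have Tq z : T (q z) = T z.
    apply/eqP; rewrite -subr_eq0 -(linB _ _ lT); apply/eqP/ip_eq0.
    by rewrite aT T2 -aD /D (linB _ _ (Ma_lin MC)) Cq subrr scaler0 ip0l.
  by apply: ip_ext => w; rewrite aq !aT Tq.
have qD x : q (D x) = D x by rewrite /D (linZ _ _ lq) qC.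
pose K := [set x | exists y, x = T y + D y].
have sK : subspace K.
  split; first by exists 0; rewrite (lin0 lT) (lin0 lD) addr0.
  move=> a _ _ [x ->] [y ->]; exists (a *: x + y); rewrite lT lD.
  by rewrite scalerDr; vec.
have [|p [[Mp pp ap] cp pK _]] := proj_exists sK.
  move=> g Mg _ [x ->]; exists (g x).
  by rewrite (linD _ _ (Mc_lin Mg)) (Ma_comm _ MT Mg) (Ma_comm _ MD Mg).
have CD x : C x = c%:C *: D x.
  by rewrite /D scalerA -rmorphM mulfV ?gt_eqF// scale1r.
exists p; split => // x.
- apply: (clo_fix lq (Ma_bdd Mq) _ (cp x)) => _ [y ->].
  by rewrite (linD _ _ lq) qT qD.
- move=> px; have kx : clo K x by rewrite -px.
  suff -> : C x = c%:C *: T x by rewrite ipZl mulr_ge0// ltW.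
  rewrite CD; congr (_ *: _); apply: (clo_eq lD (Ma_bdd MD) lT bT _ kx).
  move=> _ [y ->]; rewrite (linD _ _ lD) (linD _ _ lT) DT T2 addrC.
  by [].
- move=> px; have TD : T x + D x = 0.
    apply: ip_ext => w; rewrite ip0l ipDl aT aD -ipDr.
    by rewrite -(pK (T w + D w)) -?ap ?px ?ip0l//; exists w.
  have -> : C x = - (c%:C *: T x).
    rewrite CD -scalerN; congr (_ *: _); apply/eqP.
    by rewrite -subr_eq0 opprK addrC TD.
  by rewrite ipNl oppr_le0 ipZl mulr_ge0// ltW.
Qed.

Section Reduced.
Variable r : H -> H.
Hypotheses (pr : proj r)
  (nil0 : forall B, Ma B -> (forall x, r (B x) = B x) ->
     (forall x, B (r x) = B x) -> (forall x, B (B x) = 0) -> forall x, B x = 0).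

(* [(r - p) B p] and [p B (r - p)] are nilpotent. *)
Lemma reduced_proj_comm p B : proj p -> (forall x, r (p x) = p x) -> Ma B ->
  (forall x, r (B x) = B x) -> (forall x, B (r x) = B x) ->
  forall x, p (B x) = B (p x).
Proof.
move=> [Mp pp ap] rp MB rB Br x; have [Mr rr ar] := pr.
have pr' z : p (r z) = p z by exact: proj_adjoint_fix ap ar rp z.
have lp := Ma_lin Mp; have lB := Ma_lin MB; have lr := Ma_lin Mr.
transitivity (p (B (p x))); apply/eqP; last first.
  rewrite eq_sym -subr_eq0; apply/eqP.
  pose N x := B (p x) - p (B (p x)); rewrite -[LHS]/(N x); apply: nil0 => [|z|z|z].
  - by apply: Ma_sub; [exact: (Ma_comp MB Mp)|exact: (Ma_comp Mp (Ma_comp MB Mp))].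
  - by rewrite /N (linB _ _ lr) rB rp.
  - by rewrite /N pr'.
  - have -> : N (N z) = B (p (N z)) - p (B (p (N z))) by [].
    have -> : p (N z) = 0 by rewrite /N (linB _ _ lp) pp subrr.
    by rewrite (lin0 lB) (lin0 lp) subrr.
rewrite -subr_eq0; apply/eqP.
pose N x := p (B x) - p (B (p x)); rewrite -[LHS]/(N x); apply: nil0 => [|z|z|z].
- by apply: Ma_sub; [exact: (Ma_comp Mp MB)|exact: (Ma_comp Mp (Ma_comp MB Mp))].
- by rewrite /N (linB _ _ lr) !rp.
- by rewrite /N pr' Br.
- rewrite {1}/N; have -> : p (N z) = N z by rewrite /N (linB _ _ lp) !pp.
  by rewrite subrr.
Qed.

Let corner_op B := [/\ Ma B, forall x, r (B x) = B x & forall x, B (r x) = B x].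

(* Each step splits [q] along the sign of [A - a], which halves the distance
   [d] of [A] to the scalars on the range of [q]. *)
Lemma reduced_bisection A B (c : R) : corner_op A -> corner_op B -> adj A A ->
  0 < c -> (forall x, rn (B x) <= c * rn x) ->
  forall k q (a d : R), proj q -> (forall x, r (q x) = q x) -> 0 < d ->
  (forall x, q x = x -> `|ip (A x) x - a * ip x x| <= d * ip x x) ->
  forall x, q x = x -> rn (A (B x) - B (A x)) <= 2 * c * d * 2^-1 ^+ k * rn x.
Proof.
move=> [MA rA Ar] [MB rB Br] aA c0 cB; have lA := Ma_lin MA; have lB := Ma_lin MB.
elim=> [|k ih] q a d pq rq d0 hq x qx.
  have [Mq qq aq] := pq; have lq := Ma_lin Mq.
  have qA z := reduced_proj_comm pq rq MA rA Ar z.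
  have qB z := reduced_proj_comm pq rq MB rB Br z.
  (* On the range of [q] this is A - a, which has the same commutator with [B] as [A] and norm at
     most [d]; the two products cost the factor 2 c d. *)
  pose C z := A (q z) - a%:C *: q z.
  have lC : lin C.
    by apply: lin_sub; [exact: (lin_comp lA lq)|exact: lin_scale].
  have aC : adj C C.
    apply: adj_sub; last exact: adj_real.
    by move=> u v; rewrite aA aq qA.
  have hC z : `|ip (C z) z| <= d * ip z z.
    have -> : ip (C z) z = ip (A (q z)) (q z) - a * ip (q z) (q z).
      have e1 : ip (A (q z)) z = ip (A (q z)) (q z) by rewrite -aq qA qq.
      have e2 : ip (q z) z = ip (q z) (q z) by rewrite -aq qq.
      by rewrite /C ipDl ipNl ipZl e1 e2.
    apply: le_trans (hq _ (qq z)) _; rewrite ler_pM2l//.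
    by rewrite -rn_le2; exact: proj_contraction.
  have nC := numerical_radius lC aC d0 hC.
  have -> : A (B x) - B (A x) = C (B x) - B (C x).
    by rewrite /C qB qx (linB _ _ lB) (linZ _ _ lB); vec.
  apply: le_trans (rnB _ _) _; rewrite expr0 mulr1.
  have := nC (B x); have := cB (C x); have := nC x; have := cB x.
  move=> h1 h2 h3 h4.
  have : c * rn (C x) <= c * (d * rn x) by rewrite ler_pM2l.
  have : d * rn (B x) <= d * (c * rn x) by rewrite ler_pM2l.
  by lra.
have [Mq qq aq] := pq; have lq := Ma_lin Mq.
have qA z := reduced_proj_comm pq rq MA rA Ar z.
pose C z := A (q z) - a%:C *: q z.
have MC : Ma C by apply: Ma_sub; [exact: (Ma_comp MA Mq)|exact: Ma_scale].
have aC : adj C C.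
  apply: adj_sub; last exact: adj_real.
  by move=> u v; rewrite aA aq qA.
have [|p [pp qp C1 C2]] := proj_split pq MC aC.
  by move=> z; rewrite /C (linB _ _ lq) (linZ _ _ lq) qA qq.
have [Mp p2 ap] := pp; have lp := Ma_lin Mp.
have rp z : r (p z) = p z by rewrite -qp rq.
pose q' z := q z - p z; have pq' : proj q' := proj_sub pp pq qp.
have pA z := reduced_proj_comm pp rp MA rA Ar z.
have pB z := reduced_proj_comm pp rp MB rB Br z.
have d2 : 0 < d / 2 by rewrite divr_gt0.
have CE z : q z = z -> ip (C z) z = ip (A z) z - a * ip z z.
  by move=> qz; rewrite /C qz !ipE.
(* For unit vectors, the form of A - a lies between 0 and d on the range of [p] and between - d and
   0 on that of [q']; the new centers are the midpoints. *)
have i1 := ih p (a + d / 2) (d / 2) pp rp d2.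
have i2 := ih q' (a - d / 2) (d / 2) pq' _ d2.
have lr : lin r by have [Mr _ _] := pr; exact: Ma_lin.
pose x1 := p x; pose x2 := x - p x.
have px1 : p x1 = x1 by exact: p2.
have px2 : p x2 = 0 by rewrite /x2 (linB _ _ lp) p2 subrr.
have qx2 : q x2 = x2 by rewrite /x2 (linB _ _ lq) qx qp.
have {}i1 : rn (A (B x1) - B (A x1)) <= 2 * c * (d / 2) * 2^-1 ^+ k * rn x1.
  apply: i1 => // z pz; have qz : q z = z by rewrite -pz qp.
  have := hq z qz; have := C1 z pz; rewrite CE// !ler_norml.
  by lra.
have {}i2 : rn (A (B x2) - B (A x2)) <= 2 * c * (d / 2) * 2^-1 ^+ k * rn x2.
  apply: i2 => [z|z q'z|]; last by rewrite /q' qx2 px2 subr0.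
    by rewrite /q' (linB _ _ lr) rq rp.
  have pz : p z = 0.
    by rewrite -q'z /q' (linB _ _ lp) p2 (proj_adjoint_fix ap aq qp) subrr.
  have qz : q z = z by rewrite -{2}q'z /q' pz subr0.
  have := hq z qz; have := C2 z pz; rewrite CE// !ler_norml.
  by lra.
set D1 := A (B x1) - B (A x1) in i1; set D2 := A (B x2) - B (A x2) in i2.
have eD : A (B x) - B (A x) = D1 + D2.
  have ex : x = x1 + x2 by rewrite /x1 /x2 addrC subrK.
  by rewrite {1 2}ex /D1 /D2 !(linD _ _ lB, linD _ _ lA); vec.
have pD1 : p D1 = D1 by rewrite /D1 (linB _ _ lp) pA pB pB pA px1.
have pD2 : p D2 = 0 by rewrite /D2 (linB _ _ lp) pA pB pB pA px2 !(lin0 lA, lin0 lB) subr0.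
(* The two parts of [x] are orthogonal, and so are their commutators because [p] commutes with [A]
   and [B]. Pythagoras then combines the bounds without a further factor, which would undo the
   halving of [d]. *)
have o12 : ip x1 x2 = 0 by rewrite -px1 ap px2 ip0r.
have oD : ip D1 D2 = 0 by rewrite -pD1 ap pD2 ip0r.
pose K := 2 * c * (d / 2) * 2^-1 ^+ k.
have K0 : 0 <= K by rewrite /K !mulr_ge0// ?exprn_ge0// ?invr_ge0// ltW.
have -> : 2 * c * d * 2^-1 ^+ k.+1 = K by rewrite /K exprS; field.
rewrite -/K in i1 i2; move: K K0 i1 i2 => K K0 i1 i2.
have Kx : 0 <= K * rn x by rewrite mulr_ge0 ?rn_ge0.
rewrite -ler_sqr ?nnegrE ?rn_ge0// exprMn eD !rn2.
have -> : ip x x = ip x1 x1 + ip x2 x2.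
  have ex : x = x1 + x2 by rewrite /x1 /x2 addrC subrK.
  by rewrite {1 2}ex (pythagoras o12).
rewrite (pythagoras oD) -!rn2.
have h1 : rn D1 ^+ 2 <= K ^+ 2 * rn x1 ^+ 2.
  by rewrite -exprMn ler_sqr ?nnegrE ?mulr_ge0 ?rn_ge0.
have h2 : rn D2 ^+ 2 <= K ^+ 2 * rn x2 ^+ 2.
  by rewrite -exprMn ler_sqr ?nnegrE ?mulr_ge0 ?rn_ge0.
by lra.
Qed.

Lemma reduced_comm_selfadjoint A B : corner_op A -> corner_op B -> adj A A ->
  forall x, A (B x) = B (A x).
Proof.
move=> hA hB aA x; have [MA rA Ar] := hA; have [MB rB Br] := hB.
have [c c0 cB] := Ma_bdd MB; have [d d0 cA] := Ma_bdd MA; have [Mr rr ar] := pr.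
suff h : A (B (r x)) - B (A (r x)) = 0.
  by apply/eqP; rewrite -subr_eq0 -{1}(Br x) -{1}(Ar x) h.
apply: rn_small => e e0.
pose K := 2 * c * d * rn (r x) + 1.
have K0 : 0 < K.
  by rewrite /K ltr_pwDr// !mulr_ge0 ?rn_ge0// ltW.
have [N hN] := invS_small (divr_gt0 e0 K0).
have := reduced_bisection hA hB aA c0 cB N (a := 0) pr rr d0.
move=> /(_ _ (r x) (rr x)) h; apply: le_trans (h _) _.
  move=> z _; rewrite mul0r subr0; apply: le_trans (ip_abs _ _) _.
  by rewrite -rn2 expr2 mulrA ler_wpM2r// rn_ge0.
have hi : 2^-1 ^+ N <= invS N :> R.
  rewrite /invS exprVn lef_pV2 ?posrE ?exprn_gt0// -natrX ler_nat.
  exact: ltn_expl.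
have := hN N (leqnn N); rewrite ltr_pdivlMr// /K.
have h1 : 0 <= 2 * c * d * rn (r x) by rewrite !mulr_ge0 ?rn_ge0// ltW.
have h2 : 2 * c * d * rn (r x) * 2^-1 ^+ N <= 2 * c * d * rn (r x) * invS N.
  by rewrite ler_wpM2l.
have := invS_gt0 N.
rewrite [X in X <= e](_ : _ = 2 * c * d * rn (r x) * 2^-1 ^+ N); last by ring.
by lra.
Qed.

Lemma reduced_comm A B : corner_op A -> corner_op B -> forall x, A (B x) = B (A x).
Proof.
move=> hA hB x; have [MA rA Ar] := hA; have [Mr rr ar] := pr.
have [A' MA' a] := Ma_adj MA.
have rA' z : r (A' z) = A' z.
  by apply: ip_ext => w; rewrite ar !(adjC a) Ar.
have A'r z : A' (r z) = A' z by exact: proj_adjoint_fix a ar rA z.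
have lr := Ma_lin Mr; have lB : lin B by case: hB => MB _ _; exact: Ma_lin.
have e1 : A (B x) + A' (B x) = B (A x + A' x).
  have h : corner_op (fun x => A x + A' x).
    by split=> [|z|z]; [exact: Ma_add|rewrite (linD _ _ lr) rA rA'|rewrite Ar A'r].
  apply: (reduced_comm_selfadjoint h hB) => u v.
  by rewrite (adj_add a (adjC a)) addrC.
have e2 : 'i%C *: (A (B x) - A' (B x)) = B ('i%C *: (A x - A' x)).
  have h : corner_op (fun x => 'i%C *: (A x - A' x)).
    split=> [|z|z]; first by apply: Ma_scale; exact: Ma_sub.
      by rewrite (linZ _ _ lr) (linB _ _ lr) rA rA'.
    by rewrite Ar A'r.
  apply: (reduced_comm_selfadjoint h hB) => u v.
  rewrite (adj_scale _ (lin_sub (Ma_lin MA') (Ma_lin MA)) (adj_sub a (adjC a))).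
  by congr ip; rewrite conjc_i scaleNr -scalerN opprB.
move: e2; rewrite (linZ _ _ lB) => /(scalerI neq0Ci_complex) e2.
apply: ip_ext => w; move/(congr1 (ip^~ w)): e1; move/(congr1 (ip^~ w)): e2.
by rewrite !(linD _ _ lB) (linN _ lB) !ipE; lra.
Qed.

End Reduced.

Lemma corner_mulE r A B : op_mul (corner (gr r) (gr A)) (corner (gr r) (gr B)) =
  gr (fun x => r (A (r (r (B (r x)))))).
Proof. by rewrite /corner !op_mulE. Qed.

(** Without such a [B] the corner at [r] has no nonzero element of square zero, and [reduced_comm]
    makes it commutative. *)
Lemma nilpotent_of_nonabelian r : proj r -> ~ abelian_projection dot M (gr r) ->
  exists B, [/\ Ma B, exists x, B x <> 0, forall x, r (B x) = B x,
    forall x, B (r x) = B x & forall x, B (B x) = 0].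
Proof.
move=> pr nab; apply: contrapT => h; apply: nab; have [Mr rr ar] := pr.
split.
  split => //; first by apply: op_adjE => //; exact: Ma_lin.
  by rewrite op_mulE; congr gr; apply/funext => x /=.
move=> _ _ /M_gr[A MA ->] /M_gr[B MB ->]; rewrite !corner_mulE; congr gr.
apply/funext => x.
have c C : Ma C -> [/\ Ma (fun x => r (C (r x))),
    forall x, r (r (C (r x))) = r (C (r x)) & forall x, r (C (r (r x))) = r (C (r x))].
  by move=> MC; split=> [|z|z]; [exact: (Ma_comp Mr (Ma_comp MC Mr))|rewrite rr|rewrite rr].
apply: (reduced_comm pr _ (c A MA) (c B MB)) => C MC rC Cr CC z.
by apply: contrapT => Cz; apply: h; exists C; split => //; exists z.
Qed.

Lemma posM_Ma f : posM f -> Ma f.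
Proof. by case. Qed.

Lemma proj_Ma p : proj p -> Ma p.
Proof. by case. Qed.

Lemma proj_posM p : proj p -> posM p.
Proof. by move=> [Mp pp ap]; split=> // x; rewrite -pp ap ip_ge0. Qed.

Lemma proj_comp p q : proj p -> proj q -> (forall x, p (q x) = q (p x)) ->
  proj (p \o q).
Proof.
move=> [Mp pp ap] [Mq qq aq] h; split=> [|x /=|x y /=]; first exact: Ma_comp.
  by rewrite -h qq pp.
by rewrite ap aq h.
Qed.

Lemma proj_compl p : proj p -> proj (fun x => x - p x).
Proof.
by move=> h; apply: (@proj_sub p idfun) => //; split=> //; exact: Ma_id.
Qed.

Lemma form_eq0 C : lin C -> adj C C -> (forall x, ip (C x) x = 0) ->
  forall x, C x = 0.
Proof.
move=> lC aC h x; apply: rn_small => e e0.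
have k0 : 0 < 1 + rn x by have := rn_ge0 x; lra.
have := numerical_radius lC aC (divr_gt0 e0 k0) _ x; move=> hr.
apply: le_trans (hr _) _.
  move=> y; rewrite h normr0 mulr_ge0 ?ip_ge0//.
  by rewrite divr_ge0// ltW.
rewrite mulrAC ler_pdivrMr// ler_pM2l//; lra.
Qed.

(** * Projections that split into two copies of themselves *)

(* Triples [(x, (u, v))] stand for partial isometries [x |-> u], [x |-> v] with
   orthogonal ranges that add up to their common domain. *)
Definition halving_pair (s t : H * (H * H)) : Prop := ip s.2.1 t.2.2 = 0.

(** The domain must lie in the sum of the two ranges, and the ranges in the domain. Both inclusions
    are exact rather than up to closure, which makes them conditions on single elements that survive
    unions of chains. *)
Definition halving_elt (G : set (H * (H * H))) (s : H * (H * H)) : Prop :=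
  [/\ forall g, Mc g -> G (g s.1, (g s.2.1, g s.2.2)),
      rn s.2.1 = rn s.1, rn s.2.2 = rn s.1,
      exists t t', [/\ G t, G t' & s.1 = t.2.1 + t'.2.2] &
      (exists2 t, G t & t.1 = s.2.1) /\ (exists2 t, G t & t.1 = s.2.2)].

Definition halving_space (G : set (H * (H * H))) : Prop :=
  [/\ subspace (G : set (H * (H * H))%type),
      forall s t, G s -> G t -> halving_pair s t &
      forall s, G s -> halving_elt G s].

(** [GU] and [GV] share the domain of [G], which gives [U] and [V] the same initial projection [E].
    The inclusions in [halving_elt] show that F = U U' + V V' fixes the range of [E] and that [E]
    fixes the range of F, so they coincide. *)
Lemma halving_space_pisom G : halving_space G -> exists E U U' V V',
  [/\ proj E, pisom U U', pisom V V',
     (forall x, U' (U x) = E x /\ V' (V x) = E x) /\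
     (forall x, E x = U (U' x) + V (V' x)) &
     forall s, G s -> [/\ E s.1 = s.1, E s.2.1 = s.2.1 & E s.2.2 = s.2.2]].
Proof.
move=> [sG QG LG].
have linG a s t : G s -> G t -> G (a *: s + t) by exact: sG.2.
pose GU := [set q : H * H | exists v, G (q.1, (q.2, v))].
pose GV := [set q : H * H | exists u, G (q.1, (u, q.2))].
have iU : isograph GU.
  split=> [|g Mg x u [v h]|x u [v h]].
  - split; first by exists 0; exact: sG.1.
    by move=> a [x u] [x' u'] [v h] [v' h']; exists (a *: v + v'); exact: (linG a _ _ h h').
  - by exists (g v); have [h1 _ _ _ _] := LG _ h; exact: (h1 g Mg).
  - by have [_ -> _ _ _] := LG _ h.
have iV : isograph GV.
  split=> [|g Mg x v [u h]|x v [u h]].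
  - split; first by exists 0; exact: sG.1.
    by move=> a [x v] [x' v'] [u h] [u' h']; exists (a *: u + u'); exact: (linG a _ _ h h').
  - by exists (g u); have [h1 _ _ _ _] := LG _ h; exact: (h1 g Mg).
  - by have [_ _ -> _ _] := LG _ h.
have [U [U' [pU hU cU' cU]]] := isograph_pisom iU.
have [V [V' [pV hV cV' cV]]] := isograph_pisom iV.
have [MU MU' aU UUU] := pU; have [MV MV' aV VVV] := pV.
have GE s : G s -> [/\ U s.1 = s.2.1, U' s.2.1 = s.1, V s.1 = s.2.2 & V' s.2.2 = s.1].
  move: s => [x [u v]] h /=.
  have [|-> ->] := hU x u; first by exists v.
  by have [|-> ->] := hV x v; first by exists u.
have pE := pisom_proj pU; have [ME EE aE] := pE.
have pE2 := pisom_proj pV; have [ME2 EE2 aE2] := pE2.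
have fE s : G s -> U' (U s.1) = s.1 by move=> /GE[-> ->].
have fE2 s : G s -> V' (V s.1) = s.1 by move=> /GE[_ _ -> ->].
have eUV x : V' (V x) = U' (U x).
  have h1 z : (U' \o U) ((V' \o V) z) = (V' \o V) z.
    apply: (clo_fix (Ma_lin ME) (Ma_bdd ME) _ (cV' _)) => k [v [u h]].
    exact: (fE _ h).
  have h2 z : (V' \o V) ((U' \o U) z) = (U' \o U) z.
    apply: (clo_fix (Ma_lin ME2) (Ma_bdd ME2) _ (cU' _)) => k [u [v h]].
    exact: (fE2 _ h).
  have h3 := proj_adjoint_fix aE2 aE h1 x.
  by rewrite -[LHS]/((V' \o V) x) -h3 h2.
have U'v s : G s -> U' s.2.2 = 0.
  move=> h; apply: ip_ext => w; rewrite ip0l (adjC aU) ipC.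
  by apply: clo_orth (cU w) => u [x [v k]]; exact: (QG _ _ k h).
have V'u s : G s -> V' s.2.1 = 0.
  move=> h; apply: ip_ext => w; rewrite ip0l (adjC aV) ipC.
  by apply: clo_orth (cV w) => v [x [u k]]; rewrite ipC; exact: (QG _ _ h k).
have dE s : G s -> [/\ (U' \o U) s.1 = s.1, (U' \o U) s.2.1 = s.2.1 &
    (U' \o U) s.2.2 = s.2.2].
  move=> h; have [_ _ _ _ [[t ht <-] [t' ht' <-]]] := LG _ h.
  by split; exact: fE.
pose F x := U (U' x) + V (V' x).
have MF : Ma F by apply: Ma_add; [exact: (Ma_comp MU MU')|exact: (Ma_comp MV MV')].
have aF : adj F F.
  by apply: adj_add; [exact: adj_comp aU (adjC aU)|exact: adj_comp aV (adjC aV)].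
have FE x : F (U' (U x)) = U' (U x).
  apply: (clo_fix (Ma_lin MF) (Ma_bdd MF) _ (cU' _)) => k [u [v h]].
  have [_ _ _ [t [t' [ht ht' /= ->]]] _] := LG _ h.
  have [q1 q2 _ _] := GE _ ht; have [_ _ q3 q4] := GE _ ht'.
  rewrite /F (linD _ _ (Ma_lin MU')) (linD _ _ (Ma_lin MV')).
  by rewrite (U'v _ ht') (V'u _ ht) addr0 add0r q2 q4 q1 q3.
have EF x : (U' \o U) (F x) = F x.
  rewrite /F (linD _ _ (Ma_lin ME)); congr (_ + _).
    apply: (clo_fix (Ma_lin ME) (Ma_bdd ME) _ (cU _)) => k [y [v h]].
    by have [_ h2 _] := dE _ h.
  apply: (clo_fix (Ma_lin ME) (Ma_bdd ME) _ (cV _)) => k [y [v h]].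
  by have [_ _ h2] := dE _ h.
exists (U' \o U), U, U', V, V'; split => //; split=> // x.
by rewrite -[RHS]/(F x) -(proj_adjoint_fix aF aE EF x) /= FE.
Qed.

Section WanderingSpace.
Variables S S' : H -> H.
Hypotheses (MS : Ma S) (MS' : Ma S') (aS : adj S S') (S'S : forall x, S' (S x) = x).

(* With [p_n] in the kernel of [S']: [x = sum_n S^n p_n], [u = sum_n S^(2n) p_n]. *)
Inductive spread : H -> H -> Prop :=
| spread0 : spread 0 0
| spreadS p x u : S' p = 0 -> spread x u -> spread (p + S x) (p + S (S u)).

Let lS := Ma_lin MS.
Let lS' := Ma_lin MS'.

Let spreadP x u : spread x u -> exists p y w,
  [/\ S' p = 0, spread y w, x = p + S y & u = p + S (S w)].
Proof.
case=> [|p y w hp h]; last by exists p, y, w.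
exists 0, 0, 0; split; rewrite ?(lin0 lS) ?(lin0 lS') ?addr0//; exact: spread0.
Qed.

Let spread_lin a x u x' u' : spread x u -> spread x' u' ->
  spread (a *: x + x') (a *: u + u').
Proof.
move=> h; elim: h x' u' => [x' u' h|p y w hp h ih x' u']; first by rewrite !scaler0 !add0r.
move=> /spreadP[p' [y' [w' [hp' h' -> ->]]]].
have -> : a *: (p + S y) + (p' + S y') = (a *: p + p') + S (a *: y + y').
  by rewrite lS scalerDr; vec.
have -> : a *: (p + S (S w)) + (p' + S (S w')) = (a *: p + p') + S (S (a *: w + w')).
  by rewrite !lS scalerDr; vec.
by apply: spreadS; [rewrite lS' hp hp' scaler0 addr0|exact: ih].
Qed.

Let isoS x y : ip (S x) (S y) = ip x y.
Proof. by rewrite aS S'S. Qed.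

Let spread_norm x u : spread x u -> rn u = rn x.
Proof.
move=> h; suff e : ip u u = ip x x by apply/eqP; rewrite eq_le !rn_le2 e lexx.
elim: h => [//|p y w hp h ih].
have o z : ip p (S z) = 0 by rewrite ipC aS hp ip0r.
by rewrite !pythagoras// !isoS ih.
Qed.

Let spread_orth x u x' u' : spread x u -> spread x' u' -> ip u (S u') = 0.
Proof.
move=> h; elim: h x' u' => [x' u' h|p y w hp h ih x' u']; first exact: ip0l.
move=> /spreadP[p' [y' [w' [hp' h' _ ->]]]].
rewrite -(adjC aS) (linD _ _ lS') hp add0r S'S aS (linD _ _ lS') hp' add0r S'S.
exact: ih h'.
Qed.

Let spread_shift x u : spread x u -> spread (S x) (S (S u)).
Proof.
move=> h; rewrite -[S x]add0r -[S (S u)]add0r.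
by apply: spreadS; rewrite ?(lin0 lS').
Qed.

Let spread_dom x u : spread x u -> exists w, spread u w.
Proof.
elim=> [|p y w hp h [v hv]]; first by exists 0; exact: spread0.
by eexists; apply: spreadS => //; exact: spread_shift hv.
Qed.

Let spread_split x u : spread x u ->
  exists x1 u1 x2 u2, [/\ spread x1 u1, spread x2 u2 & x = u1 + S u2].
Proof.
elim=> [|p y w hp h [x1 [u1 [x2 [u2 [h1 h2 ->]]]]]].
  by exists 0, 0, 0, 0; split; rewrite ?(lin0 lS) ?addr0//; exact: spread0.
(* Prepending [p] exchanges even and odd positions, hence the swap of the two halves. *)
exists (p + S x2), (p + S (S u2)), x1, u1; split => //; first exact: spreadS.
by rewrite (linD _ _ lS); vec.
Qed.

(** Even and odd powers of [S] each carry a copy of the whole sum of the spaces S^n (ker S'): [u]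
    places the coefficients of [x] at the even powers, and [S u] at the odd ones. *)
Lemma spread_halving :
  halving_space [set s | exists x u, spread x u /\ s = (x, (u, S u))].
Proof.
split.
- split; first by exists 0, 0; split; [exact: spread0|rewrite (lin0 lS)].
  move=> a _ _ [x [u [h ->]]] [x' [u' [h' ->]]].
  by exists (a *: x + x'), (a *: u + u'); split; [exact: spread_lin|rewrite lS].
- by move=> _ _ [x [u [h ->]]] [x' [u' [h' ->]]]; exact: spread_orth h h'.
- move=> _ [x [u [h ->]]]; split => /=.
  + move=> g Mg; exists (g x), (g u); split; last by rewrite (Ma_comm _ MS Mg).
    elim: h => [|p y w hp h ih]; first by rewrite (lin0 (Mc_lin Mg)); exact: spread0.
    rewrite !(linD _ _ (Mc_lin Mg)) -!(Ma_comm _ MS Mg); apply: spreadS => //.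
    by rewrite (Ma_comm _ MS' Mg) hp (lin0 (Mc_lin Mg)).
  + exact: spread_norm h.
  + rewrite -(spread_norm h); apply/eqP; rewrite eq_le !rn_le2 isoS lexx.
    by [].
  + have [x1 [u1 [x2 [u2 [h1 h2 ->]]]]] := spread_split h.
    exists (x1, (u1, S u1)), (x2, (u2, S u2)); split => //; [by exists x1, u1|by exists x2, u2].
  + have [w hw] := spread_dom h; split; first by exists (u, (w, S w)) => //; exists u, w.
    exists (S u, (S (S w), S (S (S w)))) => //; exists (S u), (S (S w)).
    by split=> //; exact: spread_shift.
Qed.

End WanderingSpace.

(** * Unbounded diagonal operators *)

Section Diagonal.
Variable P : nat -> H -> H.
Hypotheses (pP : forall n, proj (P n))
  (oP : forall m n x, m <> n -> P m (P n x) = 0)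
  (tP : forall x, (forall n, P n x = 0) -> x = 0).

Fixpoint diag_sum (a : nat -> R) N x : H :=
  if N is n.+1 then diag_sum a n x + (a n)%:C *: P n x else 0.

(** Prescribing all components at once gives the maximal domain, so that closedness and
    self-adjointness are checked one component at a time and no convergent series appears in the
    definition. *)
Definition diag_op (a : nat -> R) : oper H :=
  [set q | forall n, P n q.2 = (a n)%:C *: P n q.1].

Let MP n : Ma (P n). Proof. by have [] := pP n. Qed.
Let lP n : lin (P n). Proof. exact: Ma_lin. Qed.
Let PP n x : P n (P n x) = P n x. Proof. by have [] := pP n. Qed.
Let aP n : adj (P n) (P n). Proof. by have [] := pP n. Qed.

Lemma Ma_diag_sum a N : Ma (diag_sum a N).
Proof.
elim: N => [|N ih]; first exact: Ma_cst0.
by apply: Ma_add => //; exact: Ma_scale.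
Qed.

Let lS a N : lin (diag_sum a N). Proof. exact/Ma_lin/Ma_diag_sum. Qed.

Lemma adj_diag_sum a N : adj (diag_sum a N) (diag_sum a N).
Proof.
elim: N => [|N ih]; first by move=> x y; rewrite ip0l ip0r.
by apply: adj_add => //; exact: adj_real.
Qed.

Lemma proj_diag_sum a N n x :
  P n (diag_sum a N x) = if (n < N)%N then (a n)%:C *: P n x else 0.
Proof.
elim: N => [|N ih] /=; first exact: lin0.
rewrite (linD _ _ (lP n)) ih (linZ _ _ (lP n)) ltnS [(n <= N)%N]leq_eqVlt.
case: eqP => [->|ne]; first by rewrite ltnn add0r PP.
by rewrite oP// scaler0 addr0.
Qed.

Lemma diag_ext x y : (forall n, P n x = P n y) -> x = y.
Proof.
move=> h; apply/eqP; rewrite -subr_eq0; apply/eqP/tP => n.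
by rewrite (linB _ _ (lP n)) h subrr.
Qed.

Let S := diag_sum (fun=> 1).

Let PS n N x : P n (S N x) = if (n < N)%N then P n x else 0.
Proof. by rewrite proj_diag_sum scale1r. Qed.

Let SS N K x : (N <= K)%N -> S K (S N x) = S N x.
Proof.
move=> h; apply: diag_ext => n; rewrite !PS.
by case: ifP => [//|]; case: ifP => // h1 h2; rewrite (leq_trans h1 h) in h2.
Qed.

Let pS N : proj (S N).
Proof. by split=> [|x|]; [exact: Ma_diag_sum|exact: SS|exact: adj_diag_sum]. Qed.

Let finite_dense x : clo [set x | exists N, S N x = x] x.
Proof.
set K := [set x | _]; have sK : subspace K.
  split; first by exists 0%N.
  move=> a u v [N hN] [N' hN']; exists (maxn N N').
  rewrite /S lS -/S -hN -hN' !SS// ?leq_maxl ?leq_maxr//.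
have [p hp op] := projection_exists x sK.
suff -> : x = p by [].
apply: diag_ext => n; apply: ip_ext => w; apply/eqP.
rewrite -subr_eq0 -ipNl -ipDl -(linB _ _ (lP n)) aP op//.
exists n.+1; apply: diag_ext => m; rewrite PS; case: ifP => // hm.
by rewrite oP// => e; rewrite e ltnS leqnn in hm.
Qed.

Lemma tends_diag_sum x : tends (fun N => diag_sum (fun=> 1) N x) x.
Proof.
move=> e e0; have [k [N hN] hk] := finite_dense x (divr_gt0 e0 (ltr0n R 2)).
exists N => n hn; have e1 : S n k = k by rewrite -hN SS.
have -> : diag_sum (fun=> 1) n x - x = S n (x - k) - (x - k).
  by rewrite /S (linB _ _ (lS _ _)) -/S e1 /S; vec.
apply: le_lt_trans (rnB _ _) _.
by have := proj_contraction (x - k) (pS n); lra.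
Qed.

Lemma diag_op_sym a x y u v : diag_op a (x, y) -> diag_op a (u, v) -> ip y u = ip x v.
Proof.
move=> hxy huv; rewrite ipC.
apply: (tends_ip (tends_diag_sum u) (tends_diag_sum v)) => n.
elim: n => [|n ih]; first by rewrite ip0l ip0r.
rewrite ipDl ipDr ih; congr (_ + _).
by rewrite !scale1r aP (hxy n) (huv n) /= !ipZr -aP ipC.
Qed.

Lemma diag_op_scale a c x y : diag_op a (x, y) -> diag_op a (c *: x, c *: y).
Proof.
by move=> h n /=; rewrite !(linZ _ _ (lP n)) (h n) /= !scalerA mulrC.
Qed.

Lemma diag_op_nonneg a : (forall n, 0 <= a n) -> nonneg_op dot (diag_op a).
Proof.
move=> a0; have sym x y u v : diag_op a (x, y) -> diag_op a (u, v) -> dot y u = dot x v.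
  move=> h h'; rewrite !dotE (diag_op_sym h h').
  by rewrite (diag_op_sym h (diag_op_scale 'i%C h')).
split; last first.
  move=> x y h; apply: dot_ge0; first exact: sym.
  (* The partial sums of [y] have a nonnegative product with [x], term by term, and approximate [y]
     too closely for <y, x> to be negative. *)
  rewrite leNgt; apply/negP => neg; have x0 : 0 < 1 + rn x by have := rn_ge0 x; lra.
  have e0 : 0 < - ip y x / (1 + rn x) by rewrite divr_gt0// oppr_gt0.
  have [N hN] := tends_diag_sum y e0; have := hN N (leqnn N).
  rewrite ltr_pdivlMr//; set d := diag_sum _ N y - y => hd.
  have : 0 <= ip (diag_sum (fun=> 1) N y) x.
    elim: N {hN d hd} => [|n ih]; first by rewrite ip0l.
    rewrite /= ipDl addr_ge0// scale1r (h n) /= ipZl mulr_ge0//.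
    by rewrite -PP aP ip_ge0.
  have -> : diag_sum (fun=> 1) N y = y + d by rewrite /d addrC subrK.
  have := ip_le d x; have := rn_ge0 d; rewrite ipDl; nra.
apply/seteqP; split=> -[u v] h.
  move=> n /=; apply: ip_ext => w; rewrite ipZl.
  (* A member of the adjoint is tested against the vectors P_n w, which lie in the domain; this
     recovers the defining equation at [n]. *)
  have Pw : diag_op a (P n w, (a n)%:C *: P n w).
    move=> m /=; rewrite (linZ _ _ (lP m)); case: (pselect (m = n)) => [->//|ne].
    by rewrite oP// !scaler0.
  have := h _ _ Pw; rewrite /= => /(congr1 (@complex.Re R)); rewrite -!/(ip _ _).
  by rewrite ipZl (aP n w u) (aP n w v) (ipC (P n v)) (ipC (P n u)) => ->.
by move=> x y k; exact: sym k h.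
Qed.

Lemma diag_op_affiliated a : affiliated dot M (diag_op a).
Proof.
split; last first.
  move=> U MU uU; have [u [lu bu e]] := bounded_opE MU.1; rewrite e in MU uU *.
  have [u' lu' pu] := unitary_pair lu bu uU; have [_ h1 h2] := pu.
  have uP n x : P n (u x) = u (P n x) by exact: (Ma_comm _ (MP n) MU).
  rewrite /gr /op_mul /op_inv; apply/seteqP; split=> -[x y] /=.
    by move=> [z -> [w h ->]] n /=; rewrite !uP (h n) (linZ _ _ lu).
  move=> h; exists (u' x); first by rewrite h2.
  exists (u' y); last by rewrite h2.
  move=> n /=; rewrite -[P n (u' y)]h1 -uP h2 (h n) /= (linZ _ _ lu').
  by rewrite -{1}(h2 x) uP h1.
split.
- split=> [x y z h1 h2||c x y x' y' h1 h2].
  + by apply: diag_ext => n; rewrite (h1 n) (h2 n).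
  + by move=> n /=; rewrite (lin0 (lP n)) scaler0.
  + by move=> n /=; rewrite !lP (h1 n) (h2 n) /= scalerDr !scalerA mulrC.
- apply/closedE => x y h n /=; apply/eqP; rewrite -subr_eq0; apply/eqP/rn_small => e e0.
  have c0 : 0 < 1 + `|a n| by have := normr_ge0 (a n); lra.
  have [u [v [Duv hu hv]]] := h _ (divr_gt0 e0 c0).
  have -> : P n y - (a n)%:C *: P n x = P n (y - v) - (a n)%:C *: P n (x - u).
    by rewrite !(linB _ _ (lP n)) (Duv n) /= scalerBr; vec.
  apply: le_trans (rnB _ _) _; rewrite rnZC.
  have := proj_contraction (y - v) (pP n); have := proj_contraction (x - u) (pP n).
  move=> h1 h2; have de : e / (1 + `|a n|) * (1 + `|a n|) = e.
    by rewrite divfK// gt_eqF.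
  have : `|a n| * rn (P n (x - u)) <= `|a n| * (e / (1 + `|a n|)).
    by rewrite ler_wpM2l//; lra.
  by lra.
- apply/denseE => x e e0; have [k [N hN] hk] := finite_dense x e0.
  exists k => //; exists (diag_sum a N k) => n /=.
  rewrite proj_diag_sum; case: ifP => // hn.
  by rewrite -hN PS hn scaler0.
Qed.

(** An everywhere defined diagonal part is split off an unbounded one, the form in which (c) is
    applied. *)
Lemma diag_op_add a b c C : (forall n x, P n (C x) = (c n)%:C *: P n x) ->
  (forall n, a n = b n + c n) -> op_add (diag_op b) (gr C) = diag_op a.
Proof.
move=> hC e; apply/seteqP; split=> -[x y] /=.
  rewrite /op_add => -[u [v /= [h /grP -> ->]]] n /=.
  by rewrite (linD _ _ (lP n)) (h n) hC /= e rmorphD scalerDl.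
move=> h; exists (y - C x), (C x); split => //; last by rewrite subrK.
by move=> n /=; rewrite (linB _ _ (lP n)) (h n) hC /= e rmorphD scalerDl addrK.
Qed.

End Diagonal.

(** * The map phi *)

Section Phi.
Variable phi : oper H -> oper H.
Hypotheses
  (phi_aff : forall T, affiliated dot M T -> affiliated dot M (phi T))
  (phi_a : forall A B, M A -> M B -> M (phi A) -> forall a b : R[i],
     phi (op_add (op_scale a A) (op_scale b B)) =
     op_add (op_scale a (phi A)) (op_scale b (phi B)))
  (phi_b : forall A, affiliated dot M A -> nonneg_op dot A -> nonneg_op dot (phi A))
  (phi_d : forall A B, M A -> M B -> phi (op_mul A B) = phi (op_mul B A))
  (phi_e : forall Z, vn_center M Z -> phi Z = Z).

Lemma phi_central f : Ma f -> Mc f -> phi (gr f) = gr f.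
Proof. by move=> h1 h2; apply: phi_e. Qed.

Lemma Mc_id : Mc idfun.
Proof. by apply: Mc_intro => //; exact: bdd_id. Qed.

Lemma posM_nonneg f : posM f -> nonneg_op dot (gr f).
Proof. by case=> Mf a p; apply: gr_nonneg => //; exact: Ma_lin. Qed.

(* [c - phi f = phi (c - f) >= 0] makes [phi f] bounded. *)
Lemma phi_pos f : posM f -> exists2 g, posM g & phi (gr f) = gr g.
Proof.
move=> hf; have [Mf a p] := hf; have [c c0 hc] := Ma_bdd Mf.
pose h x := c%:C *: x + (-1) *: f x.
have Mh : Ma h by apply: Ma_add; [exact: (Ma_scale _ Ma_id)|exact: Ma_scale].
have ph : posM h.
  split => // [x y|x]; first by rewrite /h !scaleN1r !ipE a.
  rewrite /h scaleN1r !ipE subr_ge0.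
  apply: le_trans (ip_le _ _) _; rewrite -rn2 expr2 mulrA ler_wpM2r ?rn_ge0//.
have nT := phi_b (Ma_affiliated Mf) (posM_nonneg hf).
have aT := phi_aff (Ma_affiliated Mf).
have phi1 : phi (gr idfun) = gr idfun by apply: phi_central; [exact: Ma_id|exact: Mc_id].
have eh : phi (gr h) = op_add (op_scale c%:C (gr idfun)) (op_scale (-1) (phi (gr f))).
  have := phi_a Ma_id Mf; rewrite phi1 => /(_ Ma_id c%:C (-1)) <-.
  by rewrite !op_scaleE op_addE.
have nh := phi_b (Ma_affiliated Mh) (posM_nonneg ph).
have [g [lg bg e]] : exists g, [/\ lin g, bdd g & phi (gr f) = gr g].
  apply: (bounded_of_form aT.1 nT c0) => x y Txy.
  have : phi (gr h) (x, c%:C *: x + (-1) *: y).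
    rewrite eh; exists (c%:C *: x), ((-1) *: y); split => //.
      by rewrite op_scaleE.
    by rewrite /op_scale oppr_eq0 oner_eq0; exists y.
  by move=> /(nonneg_ip nh); rewrite scaleN1r !ipE subr_ge0.
exists g => //; apply: gr_nonneg_posM; last by rewrite -e.
by apply: affiliated_Ma => //; rewrite -e.
Qed.

Lemma phi_add f g f1 g1 : Ma f -> Ma g -> Ma f1 ->
  phi (gr f) = gr f1 -> phi (gr g) = gr g1 ->
  phi (gr (fun x => f x + g x)) = gr (fun x => f1 x + g1 x).
Proof.
move=> Mf Mg Mf1 ef eg; have := phi_a Mf Mg _ 1 1.
rewrite ef eg => /(_ Mf1); rewrite !op_scaleE !op_addE => e.
have s1 (k : H -> H) : (fun x => 1 *: k x) = k by apply/funext => x; rewrite scale1r.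
have s2 (k l : H -> H) : (fun x => 1 *: k x + 1 *: l x) = (fun x => k x + l x).
  by apply/funext => x; rewrite !scale1r.
by rewrite !s2 in e.
Qed.

Lemma posM_add0 f g : posM f -> posM g -> (forall x, f x + g x = 0) ->
  forall x, f x = 0.
Proof.
move=> [Mf af pf] [Mg ag pg] h; apply: form_eq0 => //; first exact: Ma_lin.
move=> x; have := pf x; have := pg x; have : ip (f x + g x) x = 0 by rewrite h ip0l.
by rewrite ipDl; lra.
Qed.

(** The images of [g] and [h] are positive with sum 0. *)
Lemma phi_sub_null f g h : posM g -> posM h -> (forall x, f x = g x + h x) ->
  phi (gr f) = gr (fun=> 0) -> phi (gr g) = gr (fun=> 0).
Proof.
move=> hg hh e ef.
have [g1 pg1 eg] := phi_pos hg; have [h1 ph1 eh] := phi_pos hh.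
have := phi_add (posM_Ma hg) (posM_Ma hh) (posM_Ma pg1) eg eh.
have -> : (fun x => g x + h x) = f by apply/funext => x; rewrite e.
rewrite ef => /gr_inj e0; rewrite eg; congr gr; apply/funext => x.
by apply: (posM_add0 pg1 ph1) => y; rewrite -[RHS]/((fun=> 0 : H) y) e0.
Qed.

Lemma phi_trace A B : Ma A -> Ma B -> phi (gr (A \o B)) = phi (gr (B \o A)).
Proof. by move=> MA MB; rewrite -(op_mulE A B) -(op_mulE B A) phi_d. Qed.

Lemma phi_halved E U U' V V' : proj E -> pisom U U' -> pisom V V' ->
  (forall x, U' (U x) = E x) -> (forall x, V' (V x) = E x) ->
  (forall x, E x = U (U' x) + V (V' x)) -> phi (gr E) = gr (fun=> 0).
Proof.
move=> pE pU pV hU hV hE; have [MU MU' _ _] := pU; have [MV MV' _ _] := pV.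
have [g pg eg] := phi_pos (proj_posM pE).
have [Mg _ _] := pg.
have eU : phi (gr (U \o U')) = gr g.
  by rewrite (phi_trace MU MU') -eg; congr (phi (gr _)); apply/funext.
have eV : phi (gr (V \o V')) = gr g.
  by rewrite (phi_trace MV MV') -eg; congr (phi (gr _)); apply/funext.
have := phi_add (Ma_comp MU MU') (Ma_comp MV MV') Mg eU eV.
have -> : (fun x => (U \o U') x + (V \o V') x) = E by apply/funext => x; rewrite hE.
rewrite eg => /gr_inj e; congr gr; apply/funext => x.
move/(congr1 (@^~ x)): e => /eqP.
by rewrite -subr_eq0 opprD addrA subrr sub0r oppr_eq0 => /eqP.
Qed.

(* Let [E] be the support of a maximal halving space [G], so that [phi E = 0].
   Compare [1 - E] with [E] through [W]. On the central support [z] of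
   [E - W W'] the projection [1 - E] is equivalent to a part of [E], hence
   [z = phi z = 0] and [E = W W']; then [W'] copies [G] under [1 - E] and the
   maximality of [G] gives [G = 0], whereas a non-unitary [S] produces a nonzero
   halving space. *)
Lemma isometry_unitary S S' : Ma S -> Ma S' -> adj S S' ->
  (forall x, S' (S x) = x) -> forall x, S (S' x) = x.
Proof.
move=> MS MS' aS S'S.
have [||G gG maxG] := @zorn_subspace (H * (H * H))%type halving_pair halving_elt.
- move=> G G' s le [h1 h2 h3 [t [t' [ht ht' e]]] [[u hu eu] [v hv ev]]].
  split => //; first by move=> g Mg; apply: le; exact: h1.
    by exists t, t'; split => //; exact: le.
  by split; [exists u => //; exact: le|exists v => //; exact: le].
- split; first by split=> // a x y -> ->; rewrite scaler0 addr0.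
    by move=> s t -> ->; rewrite /halving_pair ip0l.
  move=> _ ->; split => //=.
  + by move=> g Mg; rewrite (lin0 (Mc_lin Mg)).
  + by exists 0, 0; split => //=; rewrite addr0.
  + by split; exists 0.
have [E [U [U' [V [V' [pE pU pV [hUV hE] fixE]]]]]] := halving_space_pisom gG.
have phiE : phi (gr E) = gr (fun=> 0).
  by apply: (phi_halved pE pU pV) => // x; have [] := hUV x.
have [ME EE aE] := pE; have lE := Ma_lin ME.
have [W [W' [pW W'n WE cmp]]] := comparison (proj_compl pE) pE.
have [MW MW' aW WWW] := pW; have W'WW' x := pisom_sym_fix x pW.
have lW := Ma_lin MW; have lW' := Ma_lin MW'.
have EW' x : E (W' x) = 0.
  by have := W'n x => /eqP; rewrite -subr_eq0 addrAC subrr sub0r oppr_eq0 => /eqP.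
have pe1 := pisom_proj (pisom_sym pW).
pose f x := E x - W (W' x).
have pf : proj f by apply: (proj_sub pe1 pE) => x; exact: WE.
have [Mf ff af] := pf; have lf := Ma_lin Mf.
(* This is the largest subspace of the kernel of [f] that is invariant under [M], so the complement
   [z] of its projection [q] is the central support of [f]. *)
pose K := [set y | forall B, Ma B -> f (B y) = 0].
have [||q [pq cq qK comq]] := @proj_exists K.
- split=> [B MB|a x y hx hy B MB]; first by rewrite (lin0 (Ma_lin MB)) (lin0 lf).
  by rewrite (Ma_lin MB) lf hx// hy// scaler0 addr0.
- move=> g Mg y hy B MB.
  by rewrite (Ma_comm _ MB Mg) (Ma_comm _ Mf Mg) hy// (lin0 (Mc_lin Mg)).
have [Mq qq aq] := pq; have lq := Ma_lin Mq.
have KA A : Ma A -> forall k, K k -> K (A k).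
  by move=> MA k hk B MB; exact: (hk (B \o A) (Ma_comp MB MA)).
have qA A : Ma A -> forall x, q (A x) = A (q x).
  move=> MA; have [A' MA' a] := Ma_adj MA.
  by apply: (comq A A') => //; [exact: Ma_lin|exact: Ma_bdd|exact: KA|exact: KA].
have fq x : f (q x) = 0.
  apply: (clo_eq0 lf (Ma_bdd Mf) _ (cq x)) => k Kk.
  exact: (Kk idfun Ma_id).
pose z x := x - q x; have pz : proj z := proj_compl pq.
have [Mz zz az] := pz; have lz := Ma_lin Mz.
have zA A : Ma A -> forall x, z (A x) = A (z x).
  by move=> MA x; rewrite /z qA// (linB _ _ (Ma_lin MA)).
have Mcz : Mc z by apply: Mc_intro => //; exact: Ma_bdd.
(* By [cmp], f B kills (1 - E) - W' W for every [B]; the range of this difference is thus in [K],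
   where [z] vanishes. *)
have zn x : z x = z (E x) + z (W' (W x)).
  apply/eqP; rewrite -(linD _ _ lz) -subr_eq0 -(linB _ _ lz); apply/eqP.
  rewrite /z qK ?subrr// => B MB.
  rewrite opprD addrA /f; apply/eqP; rewrite subr_eq0; apply/eqP.
  exact: cmp.
have pzE : proj (z \o E) by apply: proj_comp => // x; exact: zA.
have pze1 : proj (z \o (W \o W')).
  by apply: proj_comp => // x; exact: (zA _ (Ma_comp MW MW')).
have pzf : proj (z \o f) by apply: proj_comp => // x; exact: zA.
have pqE : proj (q \o E) by apply: proj_comp => // x; exact: qA.
have phi_zE : phi (gr (z \o E)) = gr (fun=> 0).
  apply: (phi_sub_null (proj_posM pzE) (proj_posM pqE) _ phiE) => x /=.
  by rewrite /z subrK.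
have phi_ze1 : phi (gr (z \o (W \o W'))) = gr (fun=> 0).
  apply: (phi_sub_null (proj_posM pze1) (proj_posM pzf) _ phi_zE) => x /=.
  by rewrite -(linD _ _ lz) /f addrC subrK.
have phi_zn1 : phi (gr (z \o (W' \o W))) = gr (fun=> 0).
  rewrite -phi_ze1 -[z \o (W \o W')]/((z \o W) \o W').
  rewrite (phi_trace (Ma_comp Mz MW) MW'); congr (phi (gr _)).
  by apply/funext => x /=; rewrite (zA _ MW').
(* Both summands of [zn] have image 0: z E is below [E], and z W' W has the image of z W W', which
   is below z E. *)
have z0 x : z x = 0.
  have := phi_add (proj_Ma pzE) (Ma_comp Mz (Ma_comp MW' MW))
    Ma_cst0 phi_zE phi_zn1.
  have -> : (fun x => (z \o E) x + (z \o (W' \o W)) x) = z.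
    by apply/funext => y /=; rewrite -zn.
  by rewrite (phi_central Mz Mcz) => /gr_inj ->; rewrite addr0.
have Ee1 x : E x = W (W' x).
  apply/eqP; rewrite -subr_eq0; apply/eqP; rewrite -[LHS]/(f x).
  by have := fq x; rewrite -{2}(subrK (q x) x) -/(z x) z0 add0r.
have WW'K k : E k = k -> W (W' k) = k by rewrite -Ee1.
have ortK k y : E k = k -> ip k (W' y) = 0 by move=> <-; rewrite aE EW' ip0r.
have isoK k l : E l = l -> ip (W' k) (W' l) = ip k l.
  by move=> h; rewrite (adjC aW) WW'K.
have normK k l k' l' : E k = k -> E l = l -> E k' = k' -> E l' = l' ->
    rn k = rn k' -> rn l = rn l' -> rn (k + W' l) = rn (k' + W' l').
  move=> h1 h2 h3 h4 e1 e2; apply/eqP; rewrite eq_le !rn_le2.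
  rewrite (pythagoras (ortK k l h1)) (pythagoras (ortK k' l' h3)).
  by rewrite (isoK l l h2) (isoK l' l' h4) -!rn2 e1 e2 lexx.
(* Since W W' = E, [W'] maps the range of [E] isometrically into that of 1 - E. The sum of [G] and
   its copy under [W'] is therefore a halving space again. *)
pose emb (a b : H * (H * H)) : H * (H * H) :=
  (a.1 + W' b.1, (a.2.1 + W' b.2.1, a.2.2 + W' b.2.2)).
have [sG QG LG] := gG.
pose G' := [set s | exists a b, [/\ G a, G b & s = emb a b]].
have GG' : G `<=` G'.
  move=> a Ga; exists a, 0; split => //; first exact: sG.1.
  by rewrite /emb /= (lin0 lW') !addr0; case: a {Ga} => ? [].
have gG' : halving_space G'.
  split.
  - split; first by apply: GG'; exact: sG.1.
    move=> c _ _ [a [b [Ga Gb ->]]] [a' [b' [Ga' Gb' ->]]].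
    exists (c *: a + a'), (c *: b + b'); split; [exact: sG.2|exact: sG.2|].
    rewrite /emb /= !lW'.
    by congr (_, (_, _)); rewrite /= scalerDr; vec.
  - move=> _ _ [a [b [Ga Gb ->]]] [a' [b' [Ga' Gb' ->]]]; rewrite /halving_pair /emb /=.
    have [f1 f2 f3] := fixE _ Ga; have [f4 f5 f6] := fixE _ Ga'.
    have [f7 f8 f9] := fixE _ Gb; have [f10 f11 f12] := fixE _ Gb'.
    have := QG _ _ Ga Ga'; have := QG _ _ Gb Gb'; rewrite /halving_pair => h1 h2.
    by rewrite !ipE isoK// h1 h2 ortK// ipC ortK// !addr0.
  - move=> _ [a [b [Ga Gb ->]]].
    have [f1 f2 f3] := fixE _ Ga; have [f7 f8 f9] := fixE _ Gb.
    have [a1 a2 a3 [t [t' [Gt Gt' at']]] [[u Gu au] [v Gv av]]] := LG _ Ga.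
    have [b1 b2 b3 [r [r' [Gr Gr' br]]] [[x Gx bx] [y Gy by']]] := LG _ Gb.
    split => /=.
    + move=> g Mg; exists (g a.1, (g a.2.1, g a.2.2)), (g b.1, (g b.2.1, g b.2.2)).
      split; [exact: a1|exact: b1|].
      by rewrite /emb /= !(linD _ _ (Mc_lin Mg)) !(Ma_comm _ MW' Mg).
    + exact: normK.
    + exact: normK.
    + exists (emb t r), (emb t' r'); split; [by exists t, r|by exists t', r'|].
      by rewrite /emb /= at' br (linD _ _ lW'); vec.
    + split; first by exists (emb u x); [exists u, x|rewrite /emb /= au bx].
      by exists (emb v y); [exists v, y|rewrite /emb /= av by'].
have G'G := maxG _ GG' gG'.
(* By maximality the copy W' a.1 is fixed by [E], while [E] also kills it. *)
have G0 a : G a -> a.1 = 0.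
  move=> Ga; have [f1 _ _] := fixE _ Ga; rewrite -(WW'K _ f1).
  suff -> : W' a.1 = 0 by exact: lin0.
  have : G' (emb 0 a) by exists 0, a; split => //; exact: sG.1.
  by move=> /G'G/fixE[]; rewrite /emb /= add0r EW' => <-.
(* A trivial [G] lies in every halving space, so by maximality the one spread by [S] is trivial
   too. *)
have GS : G `<=` [set s | exists x u, spread S S' x u /\ s = (x, (u, S u))].
  move=> a Ga; have [_ n1 n2 _ _] := LG _ Ga; have a0 := G0 _ Ga.
  exists 0, 0; split; first exact: spread0.
  rewrite (lin0 (Ma_lin MS)); case: a {Ga} a0 n1 n2 => a1 [a2 a3] /= ->.
  by rewrite rn0 => /rn_eq0 -> /rn_eq0 ->.
have SG := maxG _ GS (spread_halving MS MS' aS S'S).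
move=> x; apply/eqP; rewrite eq_sym -subr_eq0; apply/eqP.
pose p := x - S (S' x).
have hp : S' p = 0 by rewrite /p (linB _ _ (Ma_lin MS')) S'S subrr.
have : G (p + S 0, (p + S (S 0), S (p + S (S 0)))).
  apply: SG; exists (p + S 0), (p + S (S 0)); split => //.
  by apply: spreadS => //; exact: spread0.
by move=> /G0 /=; rewrite (lin0 (Ma_lin MS)) addr0.
Qed.

(** * Type I: a central projection that dominates no abelian projection *)

Hypothesis phi_c : forall A B, affiliated dot M A -> nonneg_op dot A ->
  M B -> nonneg_op dot B -> M (phi B) ->
  phi (op_add A B) = op_add (phi A) (phi B).

Lemma phi_scale c f g : Ma f -> Ma g -> phi (gr f) = gr g ->
  phi (gr (fun x => c *: f x)) = gr (fun x => c *: g x).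
Proof.
move=> Mf Mg e; have := phi_a Mf Mf; rewrite e => /(_ Mg c 0).
rewrite !op_scaleE !op_addE.
have s (k : H -> H) : (fun x => c *: k x + 0 *: k x) = (fun x => c *: k x).
  by apply/funext => x; rewrite scale0r addr0.
by rewrite !s.
Qed.

(* [phi] maps [sum_n a_n P_n] to an operator that dominates [N Z] for every
   [N], which is impossible on a dense domain unless [Z = 0]. *)
Lemma phi_blowup P (a : nat -> R) Z : (forall n, proj (P n)) ->
  (forall m n x, m <> n -> P m (P n x) = 0) ->
  (forall x, (forall n, P n x = 0) -> x = 0) -> (forall n, 0 <= a n) ->
  proj Z ->
  (forall N, exists K,
     phi (gr (diag_sum P a K)) = gr (fun x => (N%:R : R)%:C *: Z x)) ->
  forall x, Z x = 0.
Proof.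
move=> pP oP tP a0 pZ hN; have [MZ ZZ aZ] := pZ.
have [[_ _ /denseE dT] _] := phi_aff (diag_op_affiliated pP oP tP a).
move=> x0; apply: (clo_eq0 (Ma_lin MZ) (Ma_bdd MZ) _ (dT x0)) => x [y Txy] {x0}.
have bound N : N%:R * ip (Z x) x <= ip y x.
  have [K eK] := hN N; pose C := diag_sum P a K.
  (* The weights [a] are cut at [K] into a finite part [c], whose operator [C] is bounded with
     bounded image, and a nonnegative tail [b]; this is the situation of (c). *)
  pose c n := if (n < K)%N then a n else 0; pose b n := a n - c n.
  have MC : Ma C by exact: Ma_diag_sum.
  have aC : adj C C by exact: adj_diag_sum.
  have hC n u : P n (C u) = (c n)%:C *: P n u.
    by rewrite (proj_diag_sum pP oP) /c; case: ifP => // _; rewrite scale0r.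
  have b0 n : 0 <= b n by rewrite /b /c; case: ifP => _; rewrite ?subrr ?subr0.
  have C0 u : 0 <= ip (C u) u.
    rewrite /C; elim: (K) => [|k ih]; first by rewrite ip0l.
    have [_ PP aP] := pP k.
    by rewrite /= ipDl addr_ge0// ipZl mulr_ge0// -PP aP ip_ge0.
  have nC : nonneg_op dot (gr C) by apply: posM_nonneg.
  have nb := diag_op_nonneg pP oP tP b0.
  have Mphi : M (phi (gr C)) by rewrite eK; exact: Ma_scale.
  have := phi_c (diag_op_affiliated pP oP tP b) nb MC nC Mphi.
  rewrite (diag_op_add pP (a := a) hC); last by move=> n; rewrite /b subrK.
  move=> e; move: Txy; rewrite e eK => -[u [v /= [hu /grP -> ->]]].
  have := nonneg_ip (phi_b (diag_op_affiliated pP oP tP b) nb) hu.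
  by rewrite ipDl ipZl; lra.
apply: ip_eq0; rewrite -aZ ZZ; apply/eqP.
have z0 : 0 <= ip (Z x) x by rewrite -ZZ aZ ip_ge0.
rewrite eq_le z0 andbT leNgt; apply/negP => p.
have := bound (Num.trunc (ip y x / ip (Z x) x)).+1.
by have := truncnS_gt (ip y x / ip (Z x) x); rewrite ltr_pdivrMr//; lra.
Qed.

Lemma Mc_cst0 : Mc (fun=> 0).
Proof.
apply: Mc_intro => [||g Mg x]; [exact: lin_cst0|exact: bdd_cst0|].
by rewrite (lin0 (Ma_lin Mg)).
Qed.

Section NoAbelianProjection.
Variable Z : H -> H.
Hypotheses (pZ : proj Z) (McZ : Mc Z)
  (nab : forall r, proj r -> (forall x, Z (r x) = r x) -> (exists x, r x <> 0) ->
     ~ abelian_projection dot M (gr r)).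

(** With [W] from [halving], F = W' W and E - F = W W', and the trace property equates their
    images. *)
Lemma phi_half E : proj E -> (forall x, Z (E x) = E x) -> exists F,
  [/\ proj F, forall x, E (F x) = F x &
      phi (gr (fun x => E x - F x)) = phi (gr F)].
Proof.
move=> pE ZE; have [|W [W' [pW WW hE]]] := halving pE.
  move=> r pr Er rn0; apply: nilpotent_of_nonabelian => //; apply: nab => // x.
  by rewrite -Er ZE.
have [MW MW' aW WWW] := pW; have lW' := Ma_lin MW'.
have W'W' y : W' (W' y) = 0.
  by apply: ip_ext => w; rewrite !(adjC aW) WW ip0r ip0l.
exists (W' \o W); split; first exact: pisom_proj.
  by move=> x; rewrite hE /= WWW W'W' (lin0 (Ma_lin MW)) addr0.
have -> : (fun x => E x - (W' \o W) x) = W \o W'.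
  by apply/funext => x; rewrite hE /= addrC addKr.
exact: phi_trace.
Qed.

Lemma no_abelian_eq0 x : Z x = 0.
Proof.
have [MZ ZZ aZ] := pZ.
have /choice[f hf] E : exists F, proj E /\ (forall x, Z (E x) = E x) ->
    [/\ proj F, forall x, E (F x) = F x &
      phi (gr (fun x => E x - F x)) = phi (gr F)].
  have [[pE ZE]|nE] := pselect (proj E /\ forall x, Z (E x) = E x).
    by have [F hF] := phi_half pE ZE; exists F.
  (* Away from the projections under [Z] the choice is arbitrary. *)
  by exists idfun => /nE.
pose E n := iter n f Z.
have hE n : proj (E n) /\ forall x, Z (E n x) = E n x.
  elim: n => [|n ih]; first by split.
  have [pF EF _] := hf _ ih; split=> [//|y].
  by rewrite -[E n.+1 y]EF ih.2.
have pE n : proj (E n) by have [] := hE n.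
have EE n y : E n (E n.+1 y) = E n.+1 y by have [_ h _] := hf _ (hE n); exact: h.
have Ele m n : (m <= n)%N -> forall y, E m (E n y) = E n y.
  move=> /subnK <-; elim: (n - m)%N => [|k ih] y.
    by have [_ -> _] := pE m.
  by rewrite addSn -(EE (k + m)%N) ih.
pose P0 n y := E n y - E n.+1 y.
have pP0 n : proj (P0 n) by exact: proj_sub.
have lE n : lin (E n) by have [h _ _] := pE n; exact: Ma_lin.
have lt0 m n y : (m < n)%N -> P0 m (P0 n y) = 0.
  move=> mn; rewrite /P0 !(linB _ _ (lE _)) !Ele ?subrr//.
  - exact: ltnW.
  - exact: leqW (ltnW mn).
  - exact: leqW mn.
have oP0 m n y : m <> n -> P0 m (P0 n y) = 0.
  case: (ltngtP m n) => // h _; first exact: lt0.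
  have [_ _ am] := pP0 m; have [_ _ an] := pP0 n.
  by apply: ip_ext => w; rewrite am an lt0// ip0r ip0l.
have MP0 n : Ma (P0 n) by have [] := pP0 n.
(* The [P0 n] need not exhaust the space: their common kernel contains the range of 1 - Z and the
   intersection of the ranges of the [E n]. Its projection [p] completes the family, as a densely
   defined diagonal operator requires. *)
pose K := [set y | forall n, P0 n y = 0].
have [||p [pp cp pK _]] := @proj_exists K.
- split=> [n|a u v hu hv n]; first by rewrite (lin0 (Ma_lin (MP0 n))).
  by rewrite (Ma_lin (MP0 n)) hu hv scaler0 addr0.
- by move=> g Mg y hy n; rewrite (Ma_comm _ (MP0 n) Mg) hy (lin0 (Mc_lin Mg)).
have P0p n y : P0 n (p y) = 0.
  apply: (clo_eq0 (Ma_lin (MP0 n)) (Ma_bdd (MP0 n)) _ (cp y)) => k Kk; exact: Kk.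
have pP0' n y : p (P0 n y) = 0.
  have [_ _ ap] := pp; have [_ _ an] := pP0 n.
  by apply: ip_ext => w; rewrite ap an P0p ip0r ip0l.
(* The remainder [p] takes index 0 with weight 0 and shifts the [P0 n] by one. The weight 2^(n+1) of
   [P0 n] cancels the factor in [phiP0], so each of them contributes exactly [Z]. *)
pose P n := if n is m.+1 then P0 m else p.
pose a n : R := if n is m.+1 then 2 ^+ n else 0.
have phiE n : phi (gr (E n)) = gr (fun y => (2^-1 ^+ n : R)%:C *: Z y).
  elim: n => [|n ih].
    rewrite (phi_central MZ McZ); congr gr; apply/funext => y.
    by rewrite expr0 scale1r.
  have [h [Mh _ _] eh] := phi_pos (proj_posM (pE n.+1)).
  have [_ _ eq] := hf _ (hE n).
  have [ME1 _ _] := pE n.+1.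
  have := phi_add (MP0 n) ME1 Mh (etrans eq eh) eh.
  have -> : (fun y => P0 n y + E n.+1 y) = E n by apply/funext => y; rewrite /P0 subrK.
  rewrite ih eh => /gr_inj e; congr gr; apply/funext => y.
  move/(congr1 (@^~ y)): e => e; apply: ip_ext => w.
  move/(congr1 (ip^~ w)): e; rewrite !ipE exprS => e.
  by rewrite -mulrA e; field.
have phiP0 n : phi (gr (P0 n)) = gr (fun y => (2^-1 ^+ n.+1 : R)%:C *: Z y).
  by rewrite -phiE; have [_ _ eq] := hf _ (hE n).
have tP y : (forall n, P n y = 0) -> y = 0.
  by move=> h; have := h 0%N; rewrite /= pK// => n; exact: (h n.+1).
have pP n : proj (P n) by case: n.
have oP m n y : m <> n -> P m (P n y) = 0.
  by case: m n => [|m] [|n] //= ne; apply: oP0 => e; apply: ne; rewrite e.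
have a0 n : 0 <= a n by case: n => //= n; rewrite exprn_ge0.
(* Index 0 contributes nothing, so N + 1 terms make N Z. *)
apply: (phi_blowup pP oP tP a0 pZ) => N; exists N.+1.
elim: N => [|N ih].
  have -> : diag_sum P a 1 = fun=> 0 by apply/funext => y; rewrite /= scale0r addr0.
  rewrite (phi_central Ma_cst0 Mc_cst0); congr gr; apply/funext => y.
  by rewrite scale0r.
have MN : Ma (diag_sum P a N.+1) by exact: Ma_diag_sum.
have := phi_add MN (Ma_scale _ (MP0 N)) (Ma_scale _ MZ) ih
  (phi_scale (a N.+1)%:C (MP0 N) (Ma_scale _ MZ) (phiP0 N)).
rewrite -[LHS]/(phi (gr (diag_sum P a N.+2))) => ->; congr gr; apply/funext => y.
rewrite scalerA -scalerDl; congr (_ *: _).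
rewrite -!rmorphM -rmorphD; congr (_%:C).
by rewrite /= -exprMn mulfV// expr1n -natr1.
Qed.

End NoAbelianProjection.

End Phi.
End Algebra.
End Hilbert.

Theorem proposition1p2 (R : realType) (H : completeNormedModType R[i])
    (dot : {dot H for (@Num.conj R[i])}) (hdot : hilbert_form dot)
    (M : set (oper H)) (hM : von_neumann_algebra dot M)
    (phi : oper H -> oper H)
    (phi_aff : forall T, affiliated dot M T -> affiliated dot M (phi T))
    (phi_a : forall A B, M A -> M B -> M (phi A) ->
       forall a b : R[i],
         phi (op_add (op_scale a A) (op_scale b B)) =
         op_add (op_scale a (phi A)) (op_scale b (phi B)))
    (phi_b : forall A, affiliated dot M A -> nonneg_op dot A ->
       nonneg_op dot (phi A))
    (phi_c : forall A B, affiliated dot M A -> nonneg_op dot A ->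
       M B -> nonneg_op dot B -> M (phi B) ->
       phi (op_add A B) = op_add (phi A) (phi B))
    (phi_d : forall A B, M A -> M B -> phi (op_mul A B) = phi (op_mul B A))
    (phi_e : forall Z, vn_center M Z -> phi Z = Z)
    (phi_f : forall A U, M A -> M U -> unitary_op dot U ->
       op_mul (op_mul (op_adj dot U) (phi A)) U = phi A) :
  finite_algebra dot M /\ type_I dot M.
Proof.
split.
(* An equivalence of 1 with [F] is an isometry [S] of the algebra with S S' = F, so it is enough
   that [S] be unitary. *)
- move=> F [MF aF FF] _ [_ [/(M_gr hM)[S MS ->] e1 e2]].
  have [S' MS' aS] := Ma_adj hM MS.
  have eS : op_adj dot (gr S) = gr S'.
    exact: op_adjE (Ma_lin hM MS') aS.
  rewrite eS op_mulE op1E in e1; rewrite eS op_mulE in e2.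
  have S'S x : S' (S x) = x by move/gr_inj/(congr1 (@^~ x)): e1.
  rewrite -e2 op1E; congr gr; apply/funext => x /=.
  exact: (isometry_unitary hdot hM phi_aff phi_a phi_b phi_d phi_e MS MS' aS S'S).
- move=> T [/(M_gr hM)[Z MZ ->] aZ ZZ] [_ cZ] Z0; apply: contrapT => nE; apply: Z0.
  have pZ : proj dot M Z.
    split => // [x|]; last exact: op_adj_gr aZ.
    by move: ZZ; rewrite op_mulE => /gr_inj/(congr1 (@^~ x)).
  rewrite op0E; congr gr; apply/funext => x.
  apply: (no_abelian_eq0 hdot hM phi_aff phi_a phi_b phi_d phi_e phi_c pZ cZ).
  move=> r pr Zr [y ry] ab; apply: nE; exists (gr r); split => //.
    by move=> _ [u /grP ->]; exists (r u); rewrite /gr /= Zr.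
  by rewrite op0E => /gr_inj r0; apply: ry; rewrite r0.
Qed.
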